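(* Let $R$ be an $F$-finite regular domain of characteristic $p>0$, let $\mathfrak{a}=\langle g_1,\ldots,g_m\rangle$ be a nonzero proper ideal of $R$, let $z=z_1,\ldots,z_m$ be variables over $R$, and let $G=z_1g_1+\cdots+z_mg_m\in R[z]=R[z_1,\ldots,z_m]$. Then $\operatorname{lce}(\mathfrak{a})=\operatorname{fpt}(G)$, where $\operatorname{lce}(\mathfrak{a})$ is the least critical exponent of $\mathfrak{a}$ in $R$ and $\operatorname{fpt}(G)$ is the $F$-pure threshold of $G$ in $R[z]$.
   Context: A ring $S$ of characteristic $p$ is $F$-finite if it is a finitely generated module over $S^p$; the definitions below apply to any $F$-finite regular domain $S$ of characteristic $p$ (such as $R$ and $R[z]$). Frobenius powers: let $q$ denote a power $p^e$, $e\ge 0$. For an ideal $\mathfrak{a}$ of $S$, $\mathfrak{a}^{[q]}=\langle f^q: f\in\mathfrak{a}\rangle$. For $k\in\mathbb{N}$ with base $p$ expansion $k=k_0+k_1p+\cdots+k_rp^r$, $\mathfrak{a}^{[k]}=\mathfrak{a}^{k_0}(\mathfrak{a}^{k_1})^{[p]}\cdots(\mathfrak{a}^{k_r})^{[p^r]}$ (with $\mathfrak{a}^0=S$). $\mathfrak{a}^{[1/q]}$ is the smallest ideal $\mathfrak{c}$ of $S$ with $\mathfrak{a}\subseteq\mathfrak{c}^{[q]}$, and $\mathfrak{a}^{[k/q]}=(\mathfrak{a}^{[k]})^{[1/q]}$ (well defined). For real $t\ge 0$ and $\mathfrak{a}$ nonzero, $\mathfrak{a}^{[t]}=\bigcup_k\mathfrak{a}^{[t_k]}$,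 where $(t_k)$ is any sequence of rational numbers with $p$-power denominators converging to $t$ monotonically from above, e.g. $t_k=\lceil p^kt\rceil/p^k$ (the union is of an ascending chain and independent of the sequence). Test ideals: for $t>0$, $\tau(\mathfrak{a}^t)=\bigcup_{e\ge 0}(\mathfrak{a}^{\lceil tp^e\rceil})^{[1/p^e]}$ (an ascending union), and $\tau(f^t)=\tau(\langle f\rangle^t)$ for $f\in S$. For a nonzero proper ideal $\mathfrak{a}$ of $S$: the least critical exponent is $\operatorname{lce}(\mathfrak{a})=\sup\{t>0:\mathfrak{a}^{[t]}=S\}=\min\{t>0:\mathfrak{a}^{[t]}\ne S\}$, and the $F$-pure threshold is $\operatorname{fpt}(\mathfrak{a})=\sup\{t>0:\tau(\mathfrak{a}^t)=S\}=\min\{t>0:\tau(\mathfrak{a}^t)\neq S\}$; $\operatorname{fpt}(f)=\operatorname{fpt}(\langle f\rangle)$. *)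

(* Defs.v *)
From HB Require Import structures.
From mathcomp Require Import all_boot all_order all_algebra.
From mathcomp Require Import boolp classical_sets reals.
From mathcomp Require Import mpoly.

Set Implicit Arguments.
Unset Strict Implicit.
Unset Printing Implicit Defensive.

Import Order.TTheory GRing.Theory Num.Theory.
Local Open Scope classical_set_scope.
Local Open Scope ring_scope.

Section Ideals.
Variable S : comNzRingType.
Implicit Types (a b c I J M N P : set S) (k n q : nat).

(* MathComp's [idealr_closed] only covers proper ideals; here [setT] is the
   unit ideal. *)
Definition is_ideal I :=
  [/\ I 0, (forall x y, I x -> I y -> I (x + y))
    & (forall r x, I x -> I (r * x))].

Definition idealgen (X : set S) : set S := smallest is_ideal X.

Definition idealM I J : set S := idealgen [set x * y | x in I & y in J].

Definition idealX I n : set S := iter n (idealM I) setT.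

Definition is_prime P :=
  [/\ is_ideal P, ~ P 1 & forall x y, P (x * y) -> P x \/ P y].

Definition is_maximal M :=
  [/\ is_ideal M, M <> setT
    & forall I, is_ideal I -> M `<=` I -> I = M \/ I = setT].

Definition noetherian :=
  forall I, is_ideal I -> exists n (x : 'I_n -> S), I = idealgen (range x).

Definition prime_chain n (P : 'I_n.+1 -> set S) :=
  (forall i, is_prime (P i)) /\ (forall i j : 'I_n.+1, (i < j)%N -> P i `<` P j).

Definition krull_dim n :=
  (exists P : 'I_n.+1 -> set S, prime_chain P) /\
  (forall k (P : 'I_k.+1 -> set S), prime_chain P -> (k <= n)%N).

Definition regular_local :=
  noetherian /\
  exists M, [/\ is_maximal M, (forall N, is_maximal N -> N = M)
    & exists d, krull_dim d /\ exists x : 'I_d -> S, M = idealgen (range x)].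

Definition F_finite (p : nat) :=
  exists n (s : 'I_n -> S),
    forall x, exists c : 'I_n -> S, x = \sum_(i < n) c i ^+ p * s i.

(* a^[q], for q a power of the characteristic *)
Definition frob_pow a q : set S := idealgen [set x ^+ q | x in a].

(* a^[k]; [trunc_log p k] is the position r of the leading base p digit of k *)
Definition gfrob_pow (p : nat) a k : set S :=
  \big[idealM/setT]_(i < (trunc_log p k).+1)
     frob_pow (idealX a (k %/ p ^ i %% p)) (p ^ i).

(* a^[1/q]: the intersection of all ideals c with a `<=` c^[q], hence the
   smallest such ideal whenever there is one *)
Definition frob_root a q : set S :=
  \bigcap_(c in [set c | is_ideal c /\ a `<=` frob_pow c q]) c.

Section RealExponents.
Variables (K : realType) (p : nat).
Implicit Type t : K.

(* ceil (t p^e), for t >= 0 *)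
Definition ceil_pow t (e : nat) : nat := `|Num.ceil (t * (p ^ e)%:R)|%N.

(* a^[t], through the sequence t_e = ceil (t p^e) / p^e *)
Definition frob_rpow a t : set S :=
  \bigcup_(e in [set: nat]) frob_root (gfrob_pow p a (ceil_pow t e)) (p ^ e).

(* tau(a^t) *)
Definition test_ideal a t : set S :=
  \bigcup_(e in [set: nat]) frob_root (idealX a (ceil_pow t e)) (p ^ e).

Definition lce a : K := sup [set t : K | 0 < t /\ frob_rpow a t = setT].

Definition fpt a : K := sup [set t : K | 0 < t /\ test_ideal a t = setT].

Definition fpt_elt (f : S) : K := fpt (idealgen [set f]).

End RealExponents.
End Ideals.

Arguments noetherian S : clear implicits.
Arguments krull_dim S n : clear implicits.
Arguments regular_local S : clear implicits.
Arguments F_finite S p : clear implicits.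
Arguments lce {S} K p a.
Arguments fpt {S} K p a.
Arguments fpt_elt {S} K p f.

Record primeIdeal (R : comNzRingType) := PrimeIdeal {
  prime_set : set R;
  prime_setP : is_prime prime_set
}.

(* The localization R_P of a domain R at a prime P, as the subring of the
   fraction field of R whose elements are the a / s with s not in P. *)
Section Localization.
Variables (R : idomainType) (P : primeIdeal R).

Definition loc_pred : {pred {fraction R}} :=
  fun x => `[< exists a s : R, ~ prime_set P s /\ x = tofrac a / tofrac s >].

Lemma loc_predP x :
  reflect (exists a s : R, ~ prime_set P s /\ x = tofrac a / tofrac s) (x \in loc_pred).
Proof. exact: asboolP. Qed.

Lemma prime_denom_neq0 (s : R) : ~ prime_set P s -> tofrac s != 0.
Proof.
case: (prime_setP P) => -[P0 _ _] _ _ nPs; rewrite tofrac_eq0.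
by apply/eqP => s0; apply: nPs; rewrite s0.
Qed.

Lemma prime_denomM (s t : R) : ~ prime_set P s -> ~ prime_set P t -> ~ prime_set P (s * t).
Proof. by case: (prime_setP P) => _ _ PM nPs nPt /PM[]. Qed.

Lemma loc_subring : subring_closed loc_pred.
Proof.
split.
- apply/loc_predP; exists 1, 1; case: (prime_setP P) => _ nP1 _.
  by split => //; rewrite tofrac1 divr1.
- move=> _ _ /loc_predP[a [s [nPs ->]]] /loc_predP[b [t [nPt ->]]].
  apply/loc_predP; exists (a * t - b * s), (s * t).
  split; first exact: prime_denomM.
  rewrite -mulNr addf_div ?prime_denom_neq0 //.
  by rewrite mulNr -!tofracM -tofracB.
- move=> _ _ /loc_predP[a [s [nPs ->]]] /loc_predP[b [t [nPt ->]]].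
  apply/loc_predP; exists (a * b), (s * t).
  by split; [exact: prime_denomM | rewrite mulf_div -!tofracM].
Qed.

HB.instance Definition _ :=
  GRing.isSubringClosed.Build {fraction R} loc_pred loc_subring.

Record localization := Localization {
  loc_val :> {fraction R};
  _ : loc_val \in loc_pred
}.

HB.instance Definition _ := [isSub for loc_val].
HB.instance Definition _ := [Choice of localization by <:].
HB.instance Definition _ := [SubChoice_isSubComNzRing of localization by <:].

End Localization.

Definition regular_domain (R : idomainType) :=
  noetherian R /\ forall P : primeIdeal R, regular_local (localization P).

(* Main.v *)
Require Import Defs.
From HB Require Import structures.
From mathcomp Require Import all_boot all_order all_algebra.
From mathcomp Require Import boolp classical_sets reals.
From mathcomp Require Import mpoly ring zify.

(* Both thresholds are governed by membership of 1, since a union of ideals is the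
   whole ring iff one of them contains 1. Put q = p^e; it suffices
   that (a^[k])^[1/q] = R iff (G^k)^[1/q] = R[z] for all k and e. For k < p, the
   coefficients of G^k generate a^k (differentiate in z_i: k is a unit), and
   since exponents below p do not interfere with p-th powers, for every k the
   coefficients of G^k generate a^[k]. Hence a^[k] is contained in b^[q] exactly
   when G^k is in (b R[z])^[q], which is one direction. For the other, if k >= q
   then a^[k] lies in a^[q]. If k < q and G^k is in c^[q] with c proper, take a
   maximal ideal M containing the contraction of c to R; near M, R is free over
   R^q, so comparing coordinates shows that the coefficients of G^k lie in M^[q].

   Freeness (Kunz) for a regular local F-finite domain A of dimension d: write
   K(P) for the residue field of A at a prime P and M for the maximal ideal. The
   q^d monomials of degree below q in each parameter, times a basis of K(M) over
   K(M)^q, generate A over A^q, so it suffices that the fraction field K(0) has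
   degree at least q^d [K(M) : K(M)^q] over its q-th powers. This degree grows by a
   factor at least q at each step P < Q of a saturated chain of primes: comparing
   lengths over the one-dimensional local ring B = (A / P)_Q, for x nonzero in its
   maximal ideal and l = length (B / xB), one has
   q l [K(Q) : K(Q)^q] = length_{B^q} (B / x^q B) <= [K(P) : K(P)^q] l. *)

Set Implicit Arguments.
Unset Strict Implicit.
Unset Printing Implicit Defensive.

Import Order.TTheory GRing.Theory Num.Theory.
Local Open Scope classical_set_scope.
Local Open Scope ring_scope.

Lemma bounded_maximum (Pr : nat -> Prop) b :
  Pr 0 -> (forall k, Pr k -> (k <= b)%N) ->
  exists2 m, Pr m & forall k, Pr k -> (k <= m)%N.
Proof.
move=> Pr0 leb.
have exP : exists k, `[< Pr k >] by exists 0; apply/asboolP.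
have ubP k : `[< Pr k >] -> (k <= b)%N by move/asboolP/leb.
case: (ex_maxnP exP ubP) => m /asboolP Pm maxm.
by exists m => // k Pk; apply: maxm; apply/asboolP.
Qed.

Lemma not_subsetP (T : Type) (X Y : set T) :
  ~ (X `<=` Y) -> exists2 x, X x & ~ Y x.
Proof.
move=> nXY; apply: contrapT => nex; apply: nXY => x Xx.
by apply: contrapT => nYx; apply: nex; exists x.
Qed.

(** * Ideals *)

Section IdealTheory.
Variable A : comNzRingType.
Implicit Types (I J P M N X Y : set A).

Lemma set_sum N (T : Type) (r : seq T) (D : pred T) (F : T -> A) :
  N 0 -> (forall x y, N x -> N y -> N (x + y)) ->
  (forall i, D i -> N (F i)) -> N (\sum_(i <- r | D i) F i).
Proof. by move=> N0 ND NF; apply: big_ind. Qed.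

Lemma ideal_sum I (T : Type) (r : seq T) (D : pred T) (F : T -> A) :
  is_ideal I -> (forall i, D i -> I (F i)) -> I (\sum_(i <- r | D i) F i).
Proof. by case=> I0 ID _; apply: set_sum. Qed.

Lemma ideal0 I : is_ideal I -> I 0. Proof. by case. Qed.

Lemma idealD I x y : is_ideal I -> I x -> I y -> I (x + y).
Proof. by case=> _ ID _; apply: ID. Qed.

Lemma idealMl I r x : is_ideal I -> I x -> I (r * x).
Proof. by case=> _ _; apply. Qed.

Lemma idealMr I r x : is_ideal I -> I x -> I (x * r).
Proof. by rewrite mulrC; apply: idealMl. Qed.

Lemma idealN I x : is_ideal I -> I x -> I (- x).
Proof. by rewrite -mulN1r; apply: idealMl. Qed.

Lemma ideal_exp I n x : is_ideal I -> (0 < n)%N -> I x -> I (x ^+ n).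
Proof. by case: n => // n iI _; rewrite exprS; apply: idealMr. Qed.

Lemma ideal_unit I : is_ideal I -> I 1 -> I = setT.
Proof. by move=> iI I1; apply/seteqP; split=> // x _; rewrite -(mulr1 x); apply: idealMl. Qed.

Lemma idealgen_ideal X : is_ideal (idealgen X).
Proof.
split=> [J [[]]//|x y Xx Xy J JP|r x Xx J JP]; have [[_ JD JM] _] := JP.
- by apply: JD; [exact: (Xx J) | exact: (Xy J)].
- by apply: JM; exact: (Xx J).
Qed.

Lemma idealgen_sub X : X `<=` idealgen X.
Proof. exact: sub_gen_smallest. Qed.

Lemma idealgen_min X J : is_ideal J -> X `<=` J -> idealgen X `<=` J.
Proof. exact: smallest_sub. Qed.

Lemma idealgen_rangeP n (x : 'I_n -> A) y :
  idealgen (range x) y -> exists c : 'I_n -> A, y = \sum_i c i * x i.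
Proof.
move: y; apply: idealgen_min => [|_ [i _ <-]].
- split=> [|_ _ [c ->] [d ->]|r _ [c ->]].
  + by exists (fun=> 0); rewrite big1 // => i _; rewrite mul0r.
  + exists (fun i => c i + d i); rewrite -big_split.
    by apply: eq_bigr => i _; rewrite mulrDl.
  + exists (fun i => r * c i); rewrite mulr_sumr.
    by apply: eq_bigr => i _; rewrite mulrA.
- exists (fun j => (j == i)%:R); rewrite (bigD1 i) //= eqxx mul1r.
  by rewrite big1 ?addr0 // => j /negPf ->; rewrite mul0r.
Qed.

Lemma idealM_ideal I J : is_ideal (idealM I J).
Proof. exact: idealgen_ideal. Qed.

Lemma idealM_in I J x y : I x -> J y -> idealM I J (x * y).
Proof. by move=> Ix Jy; apply: idealgen_sub; exists x => //; exists y. Qed.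

Lemma idealM_min I J D : is_ideal D -> (forall x y, I x -> J y -> D (x * y)) ->
  idealM I J `<=` D.
Proof. by move=> iD IJD; apply: idealgen_min => // _ [x Ix [y Jy <-]]; apply: IJD. Qed.

Lemma frob_pow_ideal I q : is_ideal (frob_pow I q).
Proof. exact: idealgen_ideal. Qed.

Lemma frob_root_ideal I q : is_ideal (frob_root I q).
Proof.
split=> [c [[]]//|x y Xx Xy J JP|r x Xx J JP]; have [iJ _] := JP.
- by apply: idealD => //; [exact: (Xx J) | exact: (Xy J)].
- by apply: idealMl => //; exact: (Xx J).
Qed.

Lemma maximal_inverse M x : is_maximal M -> ~ M x -> exists y, M (1 - y * x).
Proof.
case=> iM _ maxM nMx.
pose J := [set z | exists2 m, M m & exists r, z = m + r * x].
have iJ : is_ideal J.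
  split=> [|_ _ [m Mm [r ->]] [m' Mm' [r' ->]]|s _ [m Mm [r ->]]].
  - by exists 0; [exact: ideal0 | exists 0; rewrite mul0r addr0].
  - exists (m + m'); first exact: idealD.
    by exists (r + r'); rewrite mulrDl addrACA.
  - exists (s * m); first exact: idealMl.
    by exists (s * r); rewrite mulrDr mulrA.
have MJ : M `<=` J by move=> m Mm; exists m => //; exists 0; rewrite mul0r addr0.
case: (maxM J iJ MJ) => JE.
- by case: nMx; rewrite -JE; exists 0; [exact: ideal0 | exists 1; rewrite add0r mul1r].
- have [m Mm [y yE]] : J 1 by rewrite JE.
  by exists y; rewrite yE addrK.
Qed.

Lemma maximal_prime M : is_maximal M -> is_prime M.
Proof.
move=> Mmax; have [iM MT _] := Mmax; split=> // [M1|x y Mxy]; first exact/MT/ideal_unit.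
have [Mx|/(maximal_inverse Mmax)[z Mz]] := pselect (M x); [by left | right].
have -> : y = (1 - z * x) * y + z * (x * y) by ring.
by apply: idealD => //; [apply: idealMr | apply: idealMl].
Qed.

Lemma noetherian_max (Fam : set (set A)) I0 : noetherian A ->
  (forall I, Fam I -> is_ideal I) -> Fam I0 ->
  exists2 I, Fam I & forall J, Fam J -> I `<=` J -> J `<=` I.
Proof.
move=> noethA FamI FamI0.
(* Zorn's lemma also asks for the union of the empty chain, hence the extra member [set0]. The union
   of any other chain is a finitely generated ideal, so one member already contains its
   generators. *)
pose Pr := [set X | Fam X \/ X = set0].
have [F FP totF|I [[FI|I0E] maxI]] := @Zorn_bigcup A Pr.
- have [FF|/forallPNP nF] := pselect (exists2 X, F X & Fam X); last first.
    right; apply/seteqP; split=> // x [X FX Xx].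
    by case: (FP X FX) Xx => [/(nF X FX) //|->].
  left; set U := \bigcup_(_ in _) _.
  have iU : is_ideal U.
    split=> [|x y [X FX Xx] [Y FY Yy]|r x [X FX Xx]].
    - by case: FF => X FX /FamI iX; exists X => //; apply: ideal0.
    - have [XY|YX] := totF X Y FX FY.
      + exists Y => //; case: (FP Y FY) => [/FamI iY|Y0]; last by rewrite Y0 in Yy.
        by apply: idealD => //; apply: XY.
      + exists X => //; case: (FP X FX) => [/FamI iX|X0]; last by rewrite X0 in Xx.
        by apply: idealD => //; apply: YX.
    - exists X => //; case: (FP X FX) => [/FamI iX|X0]; last by rewrite X0 in Xx.
      exact: idealMl.
  have [n [x Ux]] := noethA U iU.
  have [X FX xX] : exists2 X, F X /\ Fam X & forall i, X (x i).
    have : forall i : 'I_n, U (x i).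
      by move=> i; rewrite Ux; apply: idealgen_sub; exists i.
    elim: n x {Ux} => [|n IHn] x xU.
      by case: FF => X FX FamX; exists X => //; case.
    have [X [FX FamX] xX] := IHn (fun i => x (lift ord0 i)) (fun i => xU _).
    have [Y FY Yx0] := xU ord0.
    have FamY : Fam Y by case: (FP Y FY) => // Y0; rewrite Y0 in Yx0.
    have [XY|YX] := totF X Y FX FY.
    + by exists Y => // i; case: (unliftP ord0 i) => [j|] -> //; apply/XY/xX.
    + by exists X => // i; case: (unliftP ord0 i) => [j|] -> //; apply/YX.
  case: FX => FX FamX; suff -> : U = X by [].
  apply/seteqP; split=> [y|y Xy]; last by exists X.
  rewrite Ux; apply: idealgen_min; first exact: FamI.
  by move=> _ [i _ <-].
- exists I => // J FJ IJ; apply: contrapT => nJI.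
  by apply: (maxI J); [split | left].
- exists I0 => // J FJ _; exfalso.
  apply: (maxI J); last by left.
  split; first by rewrite I0E.
  by move=> /(_ 0 (ideal0 (FamI _ FJ))); rewrite I0E.
Qed.

Lemma maximal_over I : noetherian A -> is_ideal I -> ~ I 1 ->
  exists2 M, is_maximal M & I `<=` M.
Proof.
move=> noethA iI nI1.
have [||J [iJ nJ1 IJ] maxJ] :=
  @noetherian_max [set J | [/\ is_ideal J, ~ J 1 & I `<=` J]] I noethA.
- by move=> J [].
- by split.
exists J => //; split=> // [JT|N iN JN]; first by apply: nJ1; rewrite JT.
have [N1|nN1] := pselect (N 1); first by right; apply: ideal_unit.
left; apply/seteqP; split=> //; apply: (maxJ N _ JN).
by split=> // x /IJ/JN.
Qed.

(** This is the nonzero solution of a linear system with more unknowns than equations over the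
    fraction field of [A / P], by Gaussian elimination without division. *)
Lemma prime_kernel P r n (c : 'I_n -> 'I_r -> A) : is_prime P -> (r < n)%N ->
  exists2 v : 'I_n -> A, (exists i, ~ P (v i)) & forall j, P (\sum_i v i * c i j).
Proof.
move=> PP; have [iP nP1 Pmul] := PP.
elim: r n c => [|r IHr] [//|n] c rn.
  by exists (fun=> 1); [exists ord0 | case].
have [[i0 nPc]|allP] := pselect (exists i0, ~ P (c i0 ord0)); last first.
  have [v nPv Pv] := IHr n.+1 (fun i j => c i (lift ord0 j)) (ltnW rn).
  exists v => // j; case: (unliftP ord0 j) => [j'|] -> //.
  apply: ideal_sum => // i _; apply: idealMl => //.
  by apply: contrapT => nP; apply: allP; exists i.
(* Cross-multiplication with the pivot [c i0 ord0] clears column [ord0]; that column then dictates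
   the entry of [w] at [i0]. *)
pose c' (i : 'I_n) (j : 'I_r) :=
  c i0 ord0 * c (lift i0 i) (lift ord0 j) - c (lift i0 i) ord0 * c i0 (lift ord0 j).
have [v [i1 nPv] Pv] := IHr n c' rn.
pose w i := if unlift i0 i is Some i' then c i0 ord0 * v i'
            else - \sum_i' v i' * c (lift i0 i') ord0.
exists w => [|j].
  by exists (lift i0 i1); rewrite /w liftK => /Pmul[].
rewrite (bigD1_ord i0) //= /w unlift_none.
under eq_bigr do rewrite liftK.
case: (unliftP ord0 j) => [j'|] ->.
  suff -> : - (\sum_i' v i' * c (lift i0 i') ord0) * c i0 (lift ord0 j') +
     \sum_(i < n) c i0 ord0 * v i * c (lift i0 i) (lift ord0 j') =
     \sum_i v i * c' i j' by [].
  rewrite mulNr mulr_suml addrC -sumrB; apply: eq_bigr => i _.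
  by rewrite /c'; ring.
suff -> : - (\sum_i' v i' * c (lift i0 i') ord0) * c i0 ord0 +
     \sum_(i < n) c i0 ord0 * v i * c (lift i0 i) ord0 = 0 by exact: ideal0.
by rewrite mulNr mulr_suml addrC -sumrB; apply: big1 => i _; ring.
Qed.

Lemma prime_exp P n x : is_prime P -> P (x ^+ n) -> P x.
Proof.
case=> iP nP1 Pmul; elim: n => [|n IHn]; first by rewrite expr0.
by rewrite exprS => /Pmul[].
Qed.

End IdealTheory.

(** * Independence over q-th powers *)

Section FrobeniusSums.
Variables (A : comNzRingType) (q : nat).
Hypothesis chq : [pchar A].-nat q.

Lemma pchar_nat_gt0 : (0 < q)%N. Proof. by case/andP: chq. Qed.

Lemma frob0 : (0 : A) ^+ q = 0.
Proof. by rewrite expr0n gtn_eqF ?pchar_nat_gt0. Qed.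

Lemma frobD (x y : A) : (x + y) ^+ q = x ^+ q + y ^+ q.
Proof. exact: exprDn_pchar. Qed.

Lemma frobN (x : A) : (- x) ^+ q = - x ^+ q.
Proof. by apply/eqP; rewrite -addr_eq0 -frobD addNr frob0. Qed.

Lemma frobB (x y : A) : (x - y) ^+ q = x ^+ q - y ^+ q.
Proof. by rewrite frobD frobN. Qed.

Lemma frob_sum (I : Type) (r : seq I) (D : pred I) (F : I -> A) :
  (\sum_(i <- r | D i) F i) ^+ q = \sum_(i <- r | D i) F i ^+ q.
Proof. exact: (big_morph (fun x : A => x ^+ q) frobD frob0). Qed.

End FrobeniusSums.

(* Linear independence over the field of q-th powers of the residue field of
   P, with denominators cleared. *)
Definition indep (A : comNzRingType) q (P : set A) (I : finType) (a : I -> A) :=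
  forall c : I -> A, P (\sum_i c i ^+ q * a i) -> forall i, P (c i).

Section Independence.
Variables (A : comNzRingType) (q : nat).
Hypothesis chq : [pchar A].-nat q.
Implicit Types (P : set A).

(** A kernel vector of the coefficient matrix modulo [P], raised entrywise to the power [q], would
    be a relation among the [a i], because [q]-th powers are additive. *)
Lemma indep_le P n r (a : 'I_n -> A) (s : 'I_r -> A) : is_prime P -> indep q P a ->
  (forall i, exists b : 'I_r -> A, P (a i - \sum_j b j ^+ q * s j)) -> (n <= r)%N.
Proof.
move=> PP inda spana; have [iP _ _] := PP; rewrite leqNgt; apply/negP => rn.
have [b bP] := choice spana.
have [v [i nPv] Pv] := prime_kernel b PP rn.
apply: nPv; apply: inda.
have -> : \sum_i v i ^+ q * a i =
  \sum_i v i ^+ q * (a i - \sum_j b i j ^+ q * s j) +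
  \sum_j (\sum_i v i * b i j) ^+ q * s j.
  have -> : \sum_j (\sum_i v i * b i j) ^+ q * s j =
    \sum_i v i ^+ q * \sum_j b i j ^+ q * s j.
    under eq_bigr do rewrite (frob_sum chq) mulr_suml.
    rewrite exchange_big /=; apply: eq_bigr => k _; rewrite mulr_sumr.
    by apply: eq_bigr => j _; rewrite exprMn mulrA.
  by rewrite -big_split; apply: eq_bigr => k _; rewrite /= mulrBr subrK.
apply: idealD => //; apply: ideal_sum => // j _; first exact: idealMl.
by apply: idealMr => //; apply: ideal_exp => //; apply: pchar_nat_gt0 chq.
Qed.

Lemma indep_leq P n m (a : 'I_m -> A) : is_prime P -> (n <= m)%N ->
  indep q P a -> exists b : 'I_n -> A, indep q P b.
Proof.
move=> PP; elim: m a => [|m IHm] a; first by rewrite leqn0 => /eqP -> ?; exists a.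
rewrite leq_eqVlt => /predU1P[-> ?|nm inda]; first by exists a.
apply: (IHm (fun i => a (lift ord_max i))) => // c Pc i.
have := inda (fun i => if unlift ord_max i is Some j then c j else 0).
move=> /(_ _ (lift ord_max i)); rewrite liftK; apply.
rewrite (bigD1_ord ord_max) //= unlift_none frob0 // mul0r add0r.
by under eq_bigr do rewrite liftK.
Qed.

Definition spanned P (I : finType) (s : I -> A) x :=
  exists c : I -> A, P (x - \sum_i c i ^+ q * s i).

Lemma indep_bounded P : F_finite A q -> is_prime P ->
  exists b, forall n (a : 'I_n -> A), indep q P a -> (n <= b)%N.
Proof.
move=> [b [s spans]] PP; exists b => n a inda.
apply: (indep_le PP inda (s := s)) => i; have [c ->] := spans (a i).
by exists c; rewrite subrr; apply: ideal0; case: PP.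
Qed.

(** A family of largest size is a basis of the residue field at [P] over its [q]-th powers: an [x]
    with no multiple [t ^+ q * x] spanned could be added to it. The factor [t] is a denominator. *)
Lemma indep_max P : F_finite A q -> is_prime P ->
  exists n (a : 'I_n -> A), [/\ indep q P a,
    forall m (b : 'I_m -> A), indep q P b -> (m <= n)%N &
    forall x, exists2 t, ~ P t & spanned P a (t ^+ q * x)].
Proof.
move=> Ffin PP; have [b leb] := indep_bounded Ffin PP.
have [iP nP1 _] := PP.
have [||n [a inda] maxn] :=
  @bounded_maximum (fun n => exists a : 'I_n -> A, indep q P a) b.
- by exists (fun=> 0) => c _ [].
- by move=> k [a /leb].
exists n, a; split=> // [m a' ia'|x]; first by apply: maxn; exists a'.
apply: contrapT => nspan.
suff /maxn : exists a' : 'I_n.+1 -> A, indep q P a' by rewrite ltnn.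
exists (fun i => if unlift ord0 i is Some j then a j else x) => c.
rewrite (bigD1_ord ord0) //= unlift_none.
under eq_bigr do rewrite liftK.
move=> Pc.
have Pc0 : P (c ord0).
  apply: contrapT => nPc0; apply: nspan; exists (c ord0) => //.
  exists (fun i => - c (lift ord0 i)).
  under eq_bigr do rewrite frobN // mulNr.
  by rewrite sumrN opprK.
move=> i; case: (unliftP ord0 i) => [j|] -> //.
apply: (inda (fun i => c (lift ord0 i))).
rewrite -[X in P X](addKr (c ord0 ^+ q * x)); apply: idealD => //.
apply: idealN => //; apply: idealMr => //.
by apply: ideal_exp => //; apply: pchar_nat_gt0 chq.
Qed.

End Independence.

(** * Lengths over the local ring at Q modulo P *)

Section SaturatedModules.
Variables (A : comNzRingType) (P Q : set A).
Hypotheses (PP : is_prime P) (QP : is_prime Q) (PQ : P `<=` Q).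
Implicit Types (q k : nat) (X Y Z N J : set A).

Let iP : is_ideal P. Proof. by case: PP. Qed.
Let iQ : is_ideal Q. Proof. by case: QP. Qed.

Definition premod q N := [/\ P `<=` N, forall x y, N x -> N y -> N (x + y)
  & forall a x, N x -> N (a ^+ q * x)].

(* These sets correspond to the submodules, over the q-th powers, of the local
   ring (A / P)_Q. *)
Definition smod q N := premod q N /\ forall u x, ~ Q u -> N (u ^+ q * x) -> N x.

Definition sat q X := [set y | exists2 u, ~ Q u & X (u ^+ q * y)].

Definition scale q y N := sat q [set z | exists2 n, N n & P (z - y * n)].

(** For saturated modules, the supremum of such [k] is the length of [Y / X] over the [q]-th powers;
    lengths occur only as bounds on [k]. The last module may be strictly smaller than [Y]. *)
Fixpoint chain q k X Y := if k is k'.+1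
  then exists Z, [/\ smod q Z, X `<=` Z, ~ (Z `<=` X) & chain q k' Z Y]
  else X `<=` Y.

Lemma not_QM u v : ~ Q u -> ~ Q v -> ~ Q (u * v).
Proof. by move=> nu nv; case: QP => _ _ QM /QM[]. Qed.

Lemma not_Q1 : ~ Q 1. Proof. by case: QP. Qed.

Lemma not_QX n u : ~ Q u -> ~ Q (u ^+ n).
Proof. by move=> nu Qu; apply/nu/(prime_exp QP Qu). Qed.

Lemma premod0 q N : premod q N -> N 0.
Proof. by case=> PN _ _; exact: (PN _ (ideal0 iP)). Qed.

Lemma premodB q N x y : [pchar A].-nat q -> premod q N -> N x -> N y -> N (x - y).
Proof.
move=> chq [_ ND NM] Nx Ny; apply: ND => //.
have -> : - y = (- 1) ^+ q * y by rewrite frobN // expr1n mulN1r.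
exact: NM.
Qed.

Lemma premod_setT q : premod q [set: A].
Proof. by split. Qed.

Lemma smod_setT q : smod q [set: A].
Proof. by split. Qed.

Lemma smod_sat q X : premod q X -> smod q (sat q X).
Proof.
move=> [PX XD XM]; split; first split.
- by move=> x Px; exists 1; [exact: not_Q1 | rewrite expr1n mul1r; apply: PX].
- move=> x y [u nu Xx] [v nv Xy]; exists (u * v); first exact: not_QM.
  rewrite exprMn mulrDr; apply: XD; last by rewrite -mulrA; apply: XM.
  by rewrite [u ^+ q * _]mulrC -mulrA; apply: XM.
- by move=> a x [u nu Xx]; exists u => //; rewrite mulrCA; apply: XM.
- move=> u x nu [v nv Xx]; exists (v * u); first exact: not_QM.
  by rewrite exprMn -mulrA.
Qed.

Lemma sat_sub q X : X `<=` sat q X.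
Proof. by move=> x Xx; exists 1; [exact: not_Q1 | rewrite expr1n mul1r]. Qed.

Lemma sat_min q X N : smod q N -> X `<=` N -> sat q X `<=` N.
Proof. by move=> [_ Nsat] XN x [u nu /XN/Nsat]; apply. Qed.

Lemma sat_mono q X Y : X `<=` Y -> sat q X `<=` sat q Y.
Proof. by move=> XY x [u nu /XY]; exists u. Qed.

Lemma smod_scale q y N : premod q N -> smod q (scale q y N).
Proof.
move=> Nmod; have [_ ND NM] := Nmod; apply: smod_sat; split.
- move=> x Px; exists 0; first exact: premod0 Nmod.
  by rewrite mulr0 subr0.
- move=> z z' [n Nn Pn] [n' Nn' Pn']; exists (n + n'); first exact: ND.
  by rewrite mulrDr opprD addrACA; apply: idealD.
- move=> a z [n Nn Pn]; exists (a ^+ q * n); first exact: NM.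
  by rewrite mulrCA -mulrBr; apply: idealMl.
Qed.

Lemma scale_mono q y X Y : X `<=` Y -> scale q y X `<=` scale q y Y.
Proof. by move=> XY; apply: sat_mono => z [n /XY Yn Pn]; exists n. Qed.

Lemma smod1_ideal J : smod 1 J -> is_ideal J.
Proof.
by move=> [Jmod _]; have [_ JD JM] := Jmod; split=> //; exact: premod0 Jmod.
Qed.

Lemma smod1_smod q J : smod 1 J -> smod q J.
Proof.
move=> sJ; have iJ := smod1_ideal sJ; have [[PJ JD JM] Jsat] := sJ.
split; first by split=> // a x Jx; apply: idealMl.
by move=> u x nu Jx; apply: (Jsat (u ^+ q) x (not_QX nu)); rewrite expr1.
Qed.

Lemma chain_sub q k X Y : chain q k X Y -> X `<=` Y.
Proof.
by elim: k X => //= k IHk X [Z [_ XZ _ /IHk ZY]]; apply: subset_trans ZY.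
Qed.

Lemma chain_mono q k X X' Y Y' : X' `<=` X -> Y `<=` Y' ->
  chain q k X Y -> chain q k X' Y'.
Proof.
elim: k X X' => /= [|k IHk] X X' X'X YY'.
  by move=> XY; apply: subset_trans YY'; apply: subset_trans XY.
move=> [Z [sZ XZ nZX ZY]]; exists Z; split=> //.
- exact: subset_trans XZ.
- by move=> ZX'; apply: nZX; apply: subset_trans X'X.
- exact: IHk ZY.
Qed.

Lemma chain_cat q k l X Y Z : chain q k X Y -> chain q l Y Z ->
  chain q (k + l) X Z.
Proof.
elim: k X => /= [|k IHk] X; first by move=> XY; apply: chain_mono.
by move=> [W [sW XW nWX WY]] YZ; exists W; split=> //; apply: IHk.
Qed.

(** Steps stay strict because [phi] reflects inclusions between [B] and [T]. This serves for
    scaling, colon ideals, pullback along [b] to [b ^+ q * f j], and change of scalars. *)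
Lemma chain_map q q' (phi : set A -> set A) B T k X Y :
  (forall N, smod q N -> smod q' (phi N)) ->
  (forall N N', N `<=` N' -> phi N `<=` phi N') ->
  (forall N N', smod q N -> smod q N' -> B `<=` N -> N `<=` N' -> N' `<=` T ->
    phi N' `<=` phi N -> N' `<=` N) ->
  smod q X -> B `<=` X -> Y `<=` T -> chain q k X Y -> chain q' k (phi X) (phi Y).
Proof.
move=> phismod phimono phistrict; elim: k X => /= [|k IHk] X sX BX YT.
  exact: phimono.
move=> [Z [sZ XZ nZX ZY]]; exists (phi Z); split.
- exact: phismod.
- exact: phimono.
- move=> phiZX; apply/nZX/(phistrict X Z) => //.
  by apply: subset_trans YT; apply: chain_sub ZY.
- by apply: IHk => //; apply: subset_trans XZ.
Qed.

Lemma chain_refl q k X : chain q k X X -> k = 0.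
Proof. by case: k => //= k [Z [_ _ nZX /chain_sub]]. Qed.

(* A strict step of the chain remains strict either after intersecting with Y
   or after adding Y. *)
Lemma chain_meet_join q k X Y Z : [pchar A].-nat q -> smod q X -> smod q Y -> chain q k X Z ->
  exists a b, [/\ (k <= a + b)%N, chain q a (X `&` Y) (Z `&` Y)
    & chain q b (sat q [set x + y | x in X & y in Y])
                (sat q [set x + y | x in Z & y in Y])].
Proof.
move=> chq sX sY; elim: k X sX => /= [|k IHk] X sX.
  move=> XZ; exists 0, 0; split=> //=; first exact: setSI.
  by apply: sat_mono => _ [x Xx [y Yy <-]]; exists x; [exact: XZ | exists y].
move=> [W [sW XW nWX /(IHk W sW)[a [b [kab aWZ bWZ]]]]].
have [WXI|nWXI] := pselect (W `&` Y `<=` X `&` Y); last first.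
  exists a.+1, b; split=> //=.
  - exists (W `&` Y); split=> //; last exact: setSI.
    case: sW sY => -[PW WD WM] Wsat [[PY YD YM] Ysat].
    split; first split=> [x Px|x y [? ?] [? ?]|c x [? ?]].
    + by split; [exact: PW | exact: PY].
    + by split; [exact: WD | exact: YD].
    + by split; [exact: WM | exact: YM].
    + by move=> u x nu [? ?]; split; [apply: (Wsat u) | apply: (Ysat u)].
  - apply: chain_mono bWZ => //.
    by apply: sat_mono => _ [x Xx [y Yy <-]]; exists x; [exact: XW | exists y].
exists a, b.+1; split=> /=; first by rewrite addnS.
  by apply: chain_mono aWZ => //; apply: setSI.
exists (sat q [set x + y | x in W & y in Y]); split=> //.
- case: sW sY => -[PW WD WM] Wsat [Ymod Ysat]; have [PY YD YM] := Ymod.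
  apply: smod_sat; split.
  + by move=> x Px; exists x; [exact: PW | exists 0; rewrite ?addr0 //; exact: premod0 Ymod].
  + move=> _ _ [x Wx [y Yy <-]] [x' Wx' [y' Yy' <-]].
    exists (x + x'); first exact: WD.
    by exists (y + y'); [exact: YD | rewrite addrACA].
  + move=> c _ [x Wx [y Yy <-]]; exists (c ^+ q * x); first exact: WM.
    by exists (c ^+ q * y); [exact: YM | rewrite mulrDr].
- by apply: sat_mono => _ [x Xx [y Yy <-]]; exists x; [exact: XW | exists y].
(* Modular law: in [u ^+ q * w = x + y] the element [y] lies in both [W] and [Y], hence in [X];
   saturation then puts [w] in [X]. *)
- move=> WXJ; apply: nWX => w Ww.
  have [|u nu [x Xx [y Yy wE]]] := WXJ w.
    apply: sat_sub; exists w => //; exists 0; last by rewrite addr0.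
    by case: sY => /premod0.
  have [[_ XD XM] Xsat] := sX; apply: (Xsat u) => //; rewrite -wE.
  apply: (XD _ _ Xx); apply: (proj1 (WXI y _)); split=> //.
  have -> : y = u ^+ q * w - x by rewrite -wE addrAC subrr add0r.
  have [Wmod _] := sW; apply: (premodB chq Wmod); last exact: XW.
  by case: Wmod => _ _; apply.
Qed.

(** Subadditivity of length: intersecting with [Y] gives the chain below [Y], adding [Y] the one
    above. *)
Lemma chain_split q k X Y Z : [pchar A].-nat q ->
  smod q X -> smod q Y -> smod q Z -> X `<=` Y -> Y `<=` Z -> chain q k X Z ->
  exists a b, [/\ (k <= a + b)%N, chain q a X Y & chain q b Y Z].
Proof.
move=> chq sX sY sZ XY YZ /(chain_meet_join chq sX sY)[a [b [kab aXY bYZ]]].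
exists a, b; split=> //.
- by apply: chain_mono aXY => // x Xx; split=> //; apply: XY.
- apply: chain_mono bYZ => [y Yy|].
    apply: sat_sub; exists 0; first by case: sX => /premod0.
    by exists y; rewrite ?add0r.
  apply: (sat_min sZ) => _ [z Zz [y Yy <-]].
  by case: sZ => -[_ ZD _] _; apply: ZD => //; apply: YZ.
Qed.

(** Multiplication by an element outside [P] is injective on [A / P]. *)
Lemma chain_scale q k y X Y : [pchar A].-nat q -> ~ P y -> smod q X ->
  chain q k X Y -> chain q k (scale q y X) (scale q y Y).
Proof.
move=> chq nPy sX; apply: (chain_map (B := set0) (T := setT)) => //.
- by move=> N [Nmod _]; apply: smod_scale.
- by move=> N N' NN'; apply: scale_mono.
move=> N N' sN [N'mod _] _ NN' _ NN'y n N'n.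
have [|u nu [n' Nn' Pn]] := NN'y (y * n).
  by apply: sat_sub; exists n => //; rewrite subrr; apply: ideal0.
have [[PN ND _] Nsat] := sN; apply: (Nsat u) => //.
rewrite -[X in N X](subrK n'); apply: ND => //; apply: PN.
have [_ _ PM] := PP; case: (PM y (u ^+ q * n - n')) => //.
by rewrite mulrBr mulrCA.
Qed.

Definition finite_chain q X Y := exists b, forall k, chain q k X Y -> (k <= b)%N.

Lemma finite_chain_mono q X X' Y Y' : X `<=` X' -> Y' `<=` Y ->
  finite_chain q X Y -> finite_chain q X' Y'.
Proof.
by move=> XX' Y'Y [b leb]; exists b => k kXY; apply: leb; apply: chain_mono kXY.
Qed.

(** One element is taken from each strict step; as [Q] lies in [X], a coefficient outside [Q] in a
    relation could be cancelled by saturation. This bounds the length by the degree of the residue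
    field at [Q] over its [q]-th powers. *)
Lemma chain_indep q k X Y : [pchar A].-nat q -> smod q X -> Q `<=` X ->
  chain q k X Y -> exists w : 'I_k -> A, forall c : 'I_k -> A,
    X (\sum_i c i ^+ q * w i) -> forall i, Q (c i).
Proof.
move=> chq; elim: k X => [|k IHk] X sX QX /=; first by exists (fun=> 0) => c _ [].
move=> [Z [sZ XZ nZX /(IHk _ sZ (subset_trans QX XZ))[w wP]]].
have [w0 Zw0 nXw0] := not_subsetP nZX.
exists (fun i => if unlift ord0 i is Some j then w j else w0) => c.
rewrite (bigD1_ord ord0) //= unlift_none.
under eq_bigr do rewrite liftK.
move=> Xc; have [[PX XD XM] Xsat] := sX; have [Zmod _] := sZ.
have Qc j : Q (c (lift ord0 j)).
  apply: (wP (fun j => c (lift ord0 j))).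
  rewrite -[Y in Z Y](addKr (c ord0 ^+ q * w0)) addrC.
  apply: (premodB chq Zmod); first exact: XZ.
  by case: Zmod => _ _; apply.
move=> i; case: (unliftP ord0 i) => [j|] -> //.
apply: contrapT => nQc; apply: nXw0; apply: (Xsat _ _ nQc).
rewrite -[Y in X Y](addrK (\sum_i c (lift ord0 i) ^+ q * w i)).
have [Xmod _] := sX; apply: (premodB chq Xmod) => //.
apply: QX; apply: ideal_sum => // j _; apply: idealMr => //.
by apply: ideal_exp => //; apply: pchar_nat_gt0 chq.
Qed.

Lemma smod_colon J a : smod 1 J -> smod 1 [set z | J (a * z)].
Proof.
move=> sJ; have iJ := smod1_ideal sJ; have [[PJ _ _] Jsat] := sJ.
split; first split=> /= [x Px|x y Jx Jy|b x Jx].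
- by apply: idealMl => //; apply: PJ.
- by rewrite mulrDr; apply: idealD.
- by rewrite mulrCA; apply: idealMl.
- by move=> u x nu /=; rewrite mulrCA => /Jsat; apply.
Qed.

(** Multiplication by [a] identifies the quotient of the ring by the colon ideal with
    [(J + aA) / J], up to saturation. *)
Lemma chain_colon q k a J Y : (0 < q)%N -> smod 1 J -> smod q Y ->
  Y `<=` sat 1 [set z | exists2 j, J j & exists c, z = j + a * c] ->
  chain q k J Y -> chain q k [set z | J (a * z)] [set z | Y (a * z)].
Proof.
move=> q0 sJ sY YJa; have iJ := smod1_ideal sJ.
apply: (chain_map (phi := fun N => [set z | N (a * z)]) (B := J) (T := Y)) => //.
- move=> N [[PN ND NM] Nsat]; split; first split=> /= [x Px|x y Nx Ny|b x Nx].
  + by apply: PN; apply: idealMl.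
  + by rewrite mulrDr; apply: ND.
  + by rewrite mulrCA; apply: NM.
  + by move=> u x nu /=; rewrite mulrCA => /Nsat; apply.
- by move=> N N' NN' z /= /NN'.
- move=> N N' [[PN ND NM] Nsat] [[PN' ND' NM'] _] JN NN' N'Y colon n N'n.
  have [u nu [j Jj [c]]] := YJa n (N'Y n N'n); rewrite expr1 => un.
  have uq : u ^+ q * n = u ^+ q.-1 * j + a * (u ^+ q.-1 * c).
    by rewrite -{1}(prednK q0) exprSr -mulrA un; ring.
  apply: (Nsat u) => //; rewrite uq; apply: ND.
    by apply: JN; apply: idealMl.
  apply: colon => /=.
  have -> : a * (u ^+ q.-1 * c) = (- u ^+ q.-1) * j + u ^+ q * n.
    by rewrite uq; ring.
  by apply: ND'; [apply: NN'; apply: JN; apply: idealMl | apply: NM'].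
- exact: smod1_smod.
Qed.

(** * Adjacent primes and the one-dimensional local ring *)

Section Adjacent.
Hypothesis noethA : noetherian A.
Hypothesis adj : forall I, is_prime I -> P `<=` I -> I `<=` Q -> I `<=` P \/ Q `<=` I.
Variable q : nat.
Hypothesis chq : [pchar A].-nat q.
Hypothesis Ffin : F_finite A q.

Let q_gt0 : (0 < q)%N := pchar_nat_gt0 chq.

(** Noetherian induction: an ideal [I] maximal among the counterexamples is neither above [Q] nor
    prime, so it contains a product [a * c] of two elements outside it. Then [I + aA] and the colon
    ideal of [I] by [a] are larger, and their bounds add up to one for [I]. *)
Lemma finite_chain_ideal J : smod 1 J -> ~ (J `<=` P) -> finite_chain q J setT.
Proof.
move=> sJ JP; apply: contrapT => nfin.
pose bad := [set J | [/\ smod 1 J, ~ (J `<=` P) & ~ finite_chain q J setT]].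
have [||{sJ JP nfin} I [sI IP nfin] maxI] := @noetherian_max A bad J noethA.
- by move=> I [/smod1_ideal].
- by split.
have iI := smod1_ideal sI; have [[PI _ _] Isat] := sI.
have [IQ|/not_subsetP[x Ix nQx]] := pselect (I `<=` Q); last first.
  have IT : I = setT.
    by apply: ideal_unit => //; apply: (Isat x) => //; rewrite expr1 mulr1.
  by apply: nfin; exists 0 => k; rewrite IT => /chain_refl ->.
have nI1 : ~ I 1 by move=> /IQ /not_Q1.
have [QI|nQI] := pselect (Q `<=` I).
  have [b leb] := indep_bounded chq Ffin QP.
  apply: nfin; exists b => k /(chain_indep chq (smod1_smod _ sI) QI)[w wP].
  by apply: (leb k w) => c Qc; apply: wP; apply: QI.
have [a [c [Iac nIa nIc]]] : exists a c, [/\ I (a * c), ~ I a & ~ I c].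
  apply: contrapT => nac; have [] // := adj (I := I).
  split=> // x y Ixy; apply: contrapT => /not_orP[nIx nIy].
  by apply: nac; exists x, y.
pose I1 := sat 1 [set z | exists2 j, I j & exists c, z = j + a * c].
have sI1 : smod 1 I1.
  apply: smod_sat; split.
  - by move=> x Px; exists x; [exact: PI | exists 0; rewrite mulr0 addr0].
  - move=> _ _ [x Ix [d ->]] [y Iy [e ->]]; exists (x + y); first exact: idealD.
    by exists (d + e); rewrite mulrDr addrACA.
  - move=> b _ [x Ix [d ->]]; exists (b * x); first exact: idealMl.
    by exists (b * d); rewrite expr1 mulrDr mulrCA.
have II1 : I `<=` I1.
  by move=> x Ix; apply: sat_sub; exists x => //; exists 0; rewrite mulr0 addr0.
have I1a : I1 a.
  by apply: sat_sub; exists 0; [exact: ideal0 | exists 1; rewrite add0r mulr1].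
have grow K : smod 1 K -> I `<=` K -> ~ (K `<=` I) -> finite_chain q K setT.
  move=> sK IK nKI; apply: contrapT => nf; apply: nKI; apply: maxI => //; split=> //.
  by move=> KP; apply: IP; apply: subset_trans KP.
have [b1 leb1] : finite_chain q I1 setT.
  by apply: grow => // I1I; apply: nIa; apply: I1I.
have [b2 leb2] : finite_chain q [set z | I (a * z)] setT.
  apply: grow; first exact: smod_colon.
  - by move=> x Ix; apply: idealMl.
  - by move=> cI; apply: nIc; apply: cI.
apply: nfin; exists (b2 + b1)%N => k.
case/(chain_split chq (smod1_smod q sI) (smod1_smod q sI1) (smod_setT q) II1).
- by [].
move=> k2 [k1 [kk kI1 kT]]; apply: leq_trans kk _; apply: leq_add; last exact: leb1.
apply: leb2; apply: (chain_mono _ _ (chain_colon (a := a) q_gt0 sI (smod1_smod q sI1) _ kI1)) => //.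
Qed.

Section Generator.
Variables (x : A) (l : nat).
Hypothesis chain_le_l : forall k, chain 1 k (scale 1 x setT) setT -> (k <= l)%N.
Variables (r : nat) (f : 'I_r -> A).

(* For y = x ^ q, this interpolates between y F (j = 0) and F (j = r), where F is
   the saturation of the module generated by f. *)
Definition partial_scale j := sat q [set z | exists c : 'I_r -> A,
  P (z - \sum_i (c i * (if (i < j)%N then 1 else x)) ^+ q * f i)].

Lemma smod_partial_scale j : smod q (partial_scale j).
Proof.
apply: smod_sat; split.
- move=> z Pz; exists (fun=> 0).
  rewrite big1 ?subr0 // => i _.
  by rewrite mul0r frob0 // mul0r.
- move=> z z' [c Pc] [c' Pc']; exists (fun i => c i + c' i).
  under eq_bigr do rewrite mulrDl frobD // mulrDl.
  by rewrite big_split /= opprD addrACA; apply: idealD.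
- move=> a z [c Pc]; exists (fun i => a * c i).
  under eq_bigr do rewrite -mulrA exprMn -mulrA.
  by rewrite -mulr_sumr -mulrBr; apply: idealMl.
Qed.

Lemma partial_scaleS j : partial_scale j `<=` partial_scale j.+1.
Proof.
apply: sat_mono => z [c Pc].
exists (fun i : 'I_r => if i == j :> nat then c i * x else c i).
congr (P (z - _)): Pc; apply: eq_bigr => i _.
by rewrite [(i < j.+1)%N]ltnS; case: (ltngtP i j) => //= _; rewrite ?mulr1.
Qed.

(** Modulo [partial_scale j] the next module is spanned by [f j], and [b ^+ q * f j] vanishes for
    [b] a multiple of [x]. Pulling back along [b] to [b ^+ q * f j] thus gives a chain of ideals
    above [x]. *)
Lemma chain_partial_scaleS k (j : 'I_r) :
  chain q k (partial_scale j) (partial_scale j.+1) -> (k <= l)%N.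
Proof.
pose phi N := [set b | N (b ^+ q * f j)].
move=> kj; apply: chain_le_l.
have : chain 1 k (phi (partial_scale j)) (phi (partial_scale j.+1)).
  apply: (chain_map (B := partial_scale j) (T := partial_scale j.+1)) kj => //.
  - move=> N [[PN ND NM] Nsat]; rewrite /phi; split; first split=> /= [b Pb|b b' Nb Nb'|a b Nb].
    + by apply: PN; apply: idealMr => //; apply: ideal_exp.
    + by rewrite frobD // mulrDl; apply: ND.
    + by rewrite expr1 exprMn -mulrA; apply: NM.
    + by move=> u b nu /=; rewrite expr1 exprMn -mulrA => /Nsat; apply.
  - by move=> N N' NN' b /= /NN'.
  - move=> N N' [[PN ND NM] Nsat] sN' jN NN' N'S phiN'N w N'w.
    have [u nu [c Pc]] := N'S w N'w.
    apply: (Nsat u) => //.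
    set v := u ^+ q * w in Pc *.
    have jS : N (v - (c j) ^+ q * f j).
      apply: jN; apply: sat_sub.
      exists (fun i => if i == j then 0 else c i).
      congr (P _): Pc.
      rewrite (bigD1 j) //= ltnSn mulr1 [in RHS](bigD1 j) //= eqxx ltnn mul0r frob0 // mul0r add0r.
      rewrite opprD addrA; congr (_ - _); apply: eq_bigr => i ij.
      have /negPf ij' : i != j :> nat by [].
      by rewrite (negPf ij) ltnS leq_eqVlt ij'.
    have [N'mod _] := sN'.
    rewrite -(subrK (c j ^+ q * f j) v); apply: ND => //; apply: phiN'N; rewrite /phi /=.
    rewrite -[X in N' X](subKr v); apply: (premodB chq N'mod); last exact: NN'.
    by have [_ _ N'M] := N'mod; apply: N'M.
  - exact: smod_partial_scale.
apply: chain_mono => // z [u nu [n _ Pn]].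
exists u => //; exists (fun i => if i == j then n else 0).
rewrite (bigD1 j) //= eqxx ltnn big1 ?addr0; last first.
  by move=> i /negPf ->; rewrite mul0r frob0 // mul0r.
rewrite mulrA -exprMn -mulrBl -frobB //; apply: idealMr => //; apply: ideal_exp => //.
by rewrite [n * x]mulrC -[u]expr1.
Qed.

Lemma chain_partial_scale k j : (j <= r)%N ->
  chain q k (partial_scale 0) (partial_scale j) -> (k <= j * l)%N.
Proof.
elim: j k => [|j IHj] k jr; first by move=> /chain_refl ->.
have le0 i : partial_scale 0 `<=` partial_scale i.
  by elim: i => // i IHi; apply: subset_trans (@partial_scaleS i).
case/(chain_split chq (smod_partial_scale 0) (smod_partial_scale j)
       (smod_partial_scale j.+1) (le0 j) (@partial_scaleS j)).
move=> a [b [kab aj bj]]; apply: leq_trans kab _; rewrite mulSn addnC.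
by apply: leq_add; [exact: (chain_partial_scaleS (j := Ordinal jr)) | exact: IHj (ltnW jr) aj].
Qed.

End Generator.

(** For [w] in [Z] outside [X], the quotient of [X + Aw] by [X + Qw] is, after localization, a copy
    of the residue field at [Q]; the [u i] cut it into [n] steps. *)
Lemma chain_refine_step n (u : 'I_n -> A) X Z : indep q Q u -> smod 1 X ->
  smod 1 Z -> X `<=` Z -> ~ (Z `<=` X) -> chain q n X Z.
Proof.
move=> indu sX sZ XZ /not_subsetP[w Zw nXw].
have iX := smod1_ideal sX; have iZ := smod1_ideal sZ.
(* [T j] saturates the span of [X], [Qw] and the [u i * w] with [i < j]. *)
pose T j := sat q [set z | exists g, Q g /\ exists2 c : 'I_n -> A,
  (forall i : 'I_n, (j <= i)%N -> c i = 0) &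
  X (z - g * w - (\sum_i c i ^+ q * u i) * w)].
have sT j : smod q (T j).
  apply: smod_sat; split.
  - move=> z Pz; exists 0; split; first exact: ideal0.
    exists (fun=> 0) => //; rewrite big1 => [|i _].
      by rewrite !mul0r !subr0; case: sX => -[PX _ _] _; apply: PX.
    by rewrite frob0 // mul0r.
  - move=> z z' [g [Qg [c c0 Xc]]] [g' [Qg' [c' c'0 Xc']]].
    exists (g + g'); split; first exact: idealD.
    exists (fun i => c i + c' i) => [i ji|]; first by rewrite c0 // c'0 // addr0.
    under eq_bigr do rewrite frobD // mulrDl.
    rewrite big_split /=.
    move: (idealD iX Xc Xc'); congr X; ring.
  - move=> a z [g [Qg [c c0 Xc]]].
    exists (a ^+ q * g); split; first exact: idealMl.
    exists (fun i => a * c i) => [i ji|]; first by rewrite c0 // mulr0.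
    under eq_bigr do rewrite exprMn -mulrA.
    rewrite -mulr_sumr.
    move: (idealMl (a ^+ q) iX Xc); congr X; ring.
have X_T j : X `<=` T j.
  move=> z Xz; apply: sat_sub; exists 0; split; first exact: ideal0.
  exists (fun=> 0) => //; rewrite big1 => [|i _]; first by rewrite !mul0r !subr0.
  by rewrite frob0 // mul0r.
have TZ j : T j `<=` Z.
  apply: sat_min; first exact: smod1_smod.
  move=> z [g [_ [c _ /XZ Zc]]].
  rewrite -[z](subrK (g * w)); apply: idealD => //; last exact: idealMl.
  rewrite -[z - _](subrK ((\sum_i c i ^+ q * u i) * w)).
  by apply: idealD => //; apply: idealMl.
suff chainT m : (m <= n)%N -> chain q m (T (n - m)%N) Z.
  by apply: chain_mono (chainT n _).
elim: m => [|m IHm] mn /=; first exact: TZ.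
exists (T (n - m)%N); split; [exact: sT| | |exact: IHm (ltnW mn)].
  apply: sat_mono => z [g [Qg [c c0 Xc]]].
  exists g; split=> //; exists c => // i mi; apply: c0; apply: leq_trans mi.
  by apply: leq_sub2l.
have jn : (n - m.+1 < n)%N by rewrite ltn_subrL (leq_trans _ mn).
pose j := Ordinal jn.
have jS : (n - m)%N = j.+1 by rewrite /= subnS prednK // subn_gt0.
move=> TT; have /TT[] : T (n - m)%N (u j * w).
  apply: sat_sub; exists 0; split; first exact: ideal0.
  exists (fun i => if i == j then 1 else 0) => [i|].
    by rewrite jS; case: eqP => // ->; rewrite ltnn.
  rewrite (bigD1 j) //= eqxx expr1n mul1r big1 => [|i /negPf ->].
    by rewrite mul0r subr0 addr0 subrr; apply: ideal0.
  by rewrite frob0 // mul0r.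
move=> v nQv [g [Qg [c c0 Xc]]].
(* Otherwise this element, whose product with [w] lies in [X], could be cancelled, and [w] would be
   in [X]. *)
have Qd : Q (v ^+ q * u j - g - \sum_i c i ^+ q * u i).
  apply: contrapT => nQd; apply: nXw; have [_ Xsat] := sX; apply: (Xsat _ _ nQd).
  by rewrite expr1; move: Xc; congr X; ring.
apply: nQv; have := indu (fun i => if i == j then v else - c i).
move=> /(_ _ j); rewrite eqxx; apply.
move: (idealD iQ Qd Qg); rewrite addrAC subrK; congr Q.
rewrite (bigD1 j) //= [in RHS](bigD1 j) //= eqxx (c0 j (leqnn _)).
rewrite frob0 // mul0r add0r -sumrN; congr (_ + _); apply: eq_bigr => i /negPf ->.
by rewrite frobN // mulNr.
Qed.

Lemma chain_refine n (u : 'I_n -> A) k X Y : indep q Q u -> smod 1 X ->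
  chain 1 k X Y -> chain q (k * n) X Y.
Proof.
move=> indu; elim: k X => // k IHk X sX /= [Z [sZ XZ nZX ZY]].
by rewrite mulSn; apply: (chain_cat (Y := Z)); [exact: (chain_refine_step indu) | exact: IHk].
Qed.

(** With [B] the local ring at [Q] modulo [P], the quotient [B / x^j B] is filtered by [j] copies of
    [B / xB]. *)
Lemma chain_powers x k j : ~ P x ->
  chain q k (scale q x setT) setT -> chain q (j * k) (scale q (x ^+ j) setT) setT.
Proof.
move=> nPx ch; elim: j => [|j IHj] //.
rewrite mulSn; apply: (chain_cat _ IHj).
have nPxj : ~ P (x ^+ j) by move=> /(prime_exp PP).
have := chain_scale chq nPxj (smod_scale x (premod_setT q)) ch.
apply: chain_mono => // z [u nu [n _ Pn]]; exists u => //.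
exists (x * n); first by apply: sat_sub; exists n => //; rewrite subrr; apply: ideal0.
by rewrite mulrA -exprSr.
Qed.

Lemma chain1_chain k X Y : smod 1 X -> chain 1 k X Y -> chain q k X Y.
Proof.
move=> sX; apply: (chain_map (phi := id) (B := set0) (T := setT)) => //.
by move=> N; apply: smod1_smod.
Qed.

(** [B] need not be spanned by a basis [f] of the residue field at [P], so it is compared with the
    span [F] of [f]. With [m] the length of [B / F], the chain from [x^q F] through [x^q B] to [B]
    has [m + q l n] steps; split at [F], it has at most [r l + m]. Cancelling the finite [m] and
    then [l] leaves [q n <= r]. *)
Theorem indep_adjacent n (u : 'I_n -> A) : ~ (Q `<=` P) -> indep q Q u ->
  exists w : 'I_(q * n) -> A, indep q P w.
Proof.
move=> /not_subsetP[x Qx nPx] indu.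
have [r [f [indf _ spanf]]] := indep_max chq Ffin PP.
suff qnr : (q * n <= r)%N by apply: indep_leq qnr indf.
pose J := scale 1 x setT.
have sJ : smod 1 J by apply: smod_scale; apply: premod_setT.
have nJP y N : ~ P y -> N 1 -> ~ (scale 1 y N `<=` P).
  move=> nPy N1 /(_ y) Py; apply: nPy; apply: Py; apply: sat_sub.
  by exists 1; rewrite // mulr1 subrr; apply: ideal0.
have [b leb] : finite_chain q J setT.
  by apply: finite_chain_ideal => //; apply: nJP.
have [|k /(chain1_chain sJ)/leb //|l chl lel] :=
  @bounded_maximum (fun k => chain 1 k J setT) b _.
  by [].
(* Since [x] is in [Q], the ideal [xB] is proper; the final cancellation divides by [l]. *)
have l_gt0 : (0 < l)%N.
  apply: lel => /=; exists setT; split=> //.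
  move=> /(_ 1) [//|v nv [m _]]; rewrite mulr1 expr1 => /PQ Qd; apply: nv.
  by rewrite -[v](subrK (x * m)); apply: idealD => //; apply: idealMr.
pose F := partial_scale x f r.
have sF : smod q F by apply: smod_partial_scale.
have FE z : (exists c : 'I_r -> A, P (z - \sum_i c i ^+ q * f i)) -> F z.
  move=> [c Pc]; apply: sat_sub; exists c; move: Pc; congr (P (_ - _)).
  by apply: eq_bigr => i _; rewrite ltn_ord mulr1.
(* Finitely many elements generate [A] over its [q]-th powers, so a common denominator [t] brings
   all of [A] into [F]; hence [A / F] has finite length. *)
have [t nPt tF] : exists2 t, ~ P t & forall z, F (t ^+ q * z).
  have [k [s spans]] := Ffin.
  have [t nPt tF] : exists2 t, ~ P t & forall i, F (t ^+ q * s i).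
    elim: k s {spans} => [|k IHk] s; first by exists 1; [case: PP | case].
    have [t nPt tF] := IHk (fun i => s (lift ord0 i)).
    have [t0 nPt0 /FE t0F] := spanf (s ord0).
    have [[_ _ FM] _] := sF.
    exists (t * t0); first by move=> Ptt; case: PP => _ _ /(_ _ _ Ptt)[].
    move=> i; rewrite exprMn; case: (unliftP ord0 i) => [j|] ->.
      by rewrite mulrAC mulrC; apply: FM.
    by rewrite -mulrA; apply: FM.
  exists t => // z; have [c ->] := spans z.
  have [Fmod _] := sF; have [_ FD FM] := Fmod.
  rewrite mulr_sumr; apply: set_sum => //; first exact: premod0 Fmod.
  by move=> i _; rewrite mulrCA; apply: FM.
have [bF lebF] : finite_chain q F setT.
  apply: (finite_chain_mono (X := scale 1 (t ^+ q) setT)) (finite_chain_ideal _ _) => //.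
  - move=> z [v nv [m _ Pm]]; have [[PF FD _] Fsat] := sF.
    apply: (Fsat v) => //.
    have -> : v ^+ q * z = v ^+ q.-1 * (v * z) by rewrite mulrA -exprSr prednK.
    rewrite -[v * z](subrK (t ^+ q * m)) mulrDr; apply: FD.
      by apply: PF; apply: idealMl => //; rewrite -[v]expr1.
    by rewrite mulrCA; apply: tF.
  - by apply: smod_scale; apply: premod_setT.
  - by apply: nJP => //; move=> /(prime_exp PP).
have [|k /lebF //|m chm lem] := @bounded_maximum (fun k => chain q k F setT) bF _.
  by [].
have nPxq : ~ P (x ^+ q) by move=> /(prime_exp PP).
have ch1 : chain q (q * (l * n)) (scale q (x ^+ q) setT) setT.
  apply: chain_powers => //; apply: chain_mono (chain_refine indu sJ chl) => //.
  by move=> z [v nv [y _ Py]]; exists (v ^+ q); [exact: not_QX | exists y; rewrite ?expr1].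
have := chain_cat (chain_scale chq nPxq sF chm) ch1.
have sxF : smod q (scale q (x ^+ q) F) by case: sF => ? _; apply: smod_scale.
case/(chain_split chq sxF sF (smod_setT q)) => //.
  apply: sat_min => // z [y Fy Py]; have [[PF FD FM] _] := sF.
  by rewrite -[z](subrK (x ^+ q * y)); apply: FD; [exact: PF | exact: FM].
move=> a [c [leac cha /lem cm]].
have {}cha : chain q a (partial_scale x f 0) (partial_scale x f r).
  apply: chain_mono cha => // z [v nv [d Pd]]; exists v => //.
  exists (\sum_i d i ^+ q * f i); first by apply: FE; exists d; rewrite subrr; apply: ideal0.
  move: Pd; congr (P (_ - _)); rewrite mulr_sumr; apply: eq_bigr => i _.
  by rewrite ltn0 exprMn mulrCA mulrA.
have al := chain_partial_scale lel (leqnn r) cha.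
have : (q * (l * n) <= r * l)%N.
  apply: leq_trans al; rewrite -(leq_add2l m) (leq_trans leac) // addnC leq_add2r.
  exact: cm.
by rewrite mulnCA mulnC leq_pmul2r.
Qed.

End Adjacent.

End SaturatedModules.

(** * Freeness over q-th powers for regular local rings *)

Section PrimeChains.
Variable A : comNzRingType.

(** [k] is the position of [X] in the new chain; [0] and [d.+1] place it below or above all of [P].
    In dimension [d] this shows that a chain of length [d] is saturated. *)
Lemma prime_chain_insert d (P : 'I_d.+1 -> set A) (X : set A) k :
  (k <= d.+1)%N -> prime_chain P -> is_prime X ->
  (forall i : 'I_d.+1, (i < k)%N -> P i `<` X) ->
  (forall i : 'I_d.+1, (k <= i)%N -> X `<` P i) ->
  exists P' : 'I_d.+2 -> set A, prime_chain P'.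
Proof.
move=> kd [Pp Pinc] Xp ltX gtX.
exists (fun i : 'I_d.+2 => if (i < k)%N then P (inord i)
  else if i == k :> nat then X else P (inord i.-1)).
split=> [i|i j ij]; first by case: ifP => // _; case: ifP.
have := ltn_ord i; have := ltn_ord j.
have [ik|ki|ik] := ltngtP i k; have [jk|kj|jk] := ltngtP j k; try lia; move=> jd id.
- by apply: Pinc; rewrite !inordK //; lia.
- by apply: Pinc; rewrite !inordK //; lia.
- by apply: ltX; rewrite !inordK //; lia.
- by apply: Pinc; rewrite !inordK //; lia.
- by apply: gtX; rewrite !inordK //; lia.
Qed.

Lemma principal_idealP (c y : A) : idealgen [set c] y -> exists d, y = d * c.
Proof.
move: y; apply: idealgen_min => [|_ ->]; last by exists 1; rewrite mul1r.
split=> [|_ _ [d ->] [e ->]|r _ [d ->]].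
- by exists 0; rewrite mul0r.
- by exists (d + e); rewrite mulrDl.
- by exists (r * d); rewrite mulrA.
Qed.

Lemma local_unit (M : set A) c : noetherian A ->
  (forall N, is_maximal N -> N = M) -> ~ M c -> exists d, d * c = 1.
Proof.
move=> noethA uniqM nMc; apply: contrapT => nunit.
have [|N /uniqM -> cM] := maximal_over noethA (idealgen_ideal [set c]).
  by move=> /principal_idealP[d dc]; apply: nunit; exists d.
by apply: nMc; apply: cM; apply: idealgen_sub.
Qed.

End PrimeChains.

(** * Spanning families and bases over the q-th powers *)

Section LocalBasis.
Variables (A : comNzRingType) (q : nat).
Hypothesis chq : [pchar A].-nat q.

Let q_gt0 : (0 < q)%N := pchar_nat_gt0 chq.

(** Generators are eliminated one at a time: solving the relation for [s ord0] divides by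
    [1 - m ^+ q = (1 - m) ^+ q], whose inverse is again a [q]-th power, so all coefficients remain
    [q]-th powers. *)
Lemma nakayama (M T : set A) N (s : 'I_N -> A) :
  is_ideal M -> (forall m, M m -> exists w, w * (1 - m) = 1) -> premod [set 0] q T ->
  (forall j, exists2 m : 'I_N -> A, forall l, M (m l) &
     T (s j - \sum_l m l ^+ q * s l)) ->
  forall j, T (s j).
Proof.
move=> iM unitM Tmod; have [T0 TD TM] := Tmod.
elim: N s => [s _ []//|N IHN s Ts].
have [m0 Mm0] := Ts ord0; rewrite big_ord_recl => Tm0.
have [w wm0] := unitM _ (Mm0 ord0).
pose s' l := s (lift ord0 l); pose n0 l := w * m0 (lift ord0 l).
have Tn0 : T (s ord0 - \sum_l n0 l ^+ q * s' l).
  have -> : s ord0 - \sum_l n0 l ^+ q * s' l = w ^+ q *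
    (s ord0 - (m0 ord0 ^+ q * s ord0 + \sum_i m0 (lift ord0 i) ^+ q * s (lift ord0 i))).
    under eq_bigr do rewrite exprMn -mulrA.
    rewrite -mulr_sumr opprD addrA mulrBr; congr (_ - _).
    rewrite -[X in X - _]mul1r -mulrBl mulrA -[1](expr1n _ q) -frobB // -exprMn wm0.
    by rewrite expr1n mul1r.
  exact: TM.
have Ts' : forall l, T (s' l).
  apply: IHN => j; have [m Mm] := Ts (lift ord0 j); rewrite big_ord_recl => Tm.
  exists (fun l => m (lift ord0 l) + m ord0 * n0 l) => [l|].
    by apply: idealD => //; apply: idealMr.
  have := TD _ _ Tm (TM (m ord0) _ Tn0); congr T.
  under [in RHS]eq_bigr do rewrite frobD // mulrDl exprMn -mulrA.
  rewrite big_split /= -mulr_sumr /s'; ring.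
move=> j; case: (unliftP ord0 j) => [l|] ->; first exact: Ts'.
rewrite -[s ord0](subrK (\sum_l n0 l ^+ q * s' l)); apply: (TD) => //.
by apply: (set_sum _ _ TD) => [|i _]; [exact: T0 | exact: TM].
Qed.

(** If [c i0] is nonzero in a relation, then [N - 1] elements span all [c i0 ^+ q * w j], which are
    [N] independent elements. *)
Lemma basis_of_span N (e w : 'I_N -> A) : is_prime [set (0 : A)] ->
  (forall x, exists c : 'I_N -> A, x = \sum_i c i ^+ q * e i) ->
  indep q [set 0] w -> indep q [set 0] e.
Proof.
case: N e w => [e w _ _ _ c _ []//|N] e w dom spane indw c /= c0 i0.
apply: contrapT => nc0; have [_ _ dom0] := dom.
have indw' : indep q [set 0] (fun j => c i0 ^+ q * w j).
  move=> b /= b0 j; have bc : b j * c i0 = 0.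
    apply: (indw (fun j => b j * c i0)) => /=.
    by under eq_bigr do rewrite exprMn -mulrA.
  by case: (dom0 _ _ bc).
suff : (N.+1 <= N)%N by rewrite ltnn.
apply: (indep_le chq dom indw' (s := fun l => e (lift i0 l))) => j.
have [a ->] := spane (w j).
exists (fun l => c i0 * a (lift i0 l) - a i0 * c (lift i0 l)) => /=.
have cE : \sum_l c (lift i0 l) ^+ q * e (lift i0 l) = - (c i0 ^+ q * e i0).
  move: c0; rewrite (bigD1_ord i0) //= => /eqP.
  by rewrite addr_eq0 => /eqP ->; rewrite opprK.
have -> : \sum_l (c i0 * a (lift i0 l) - a i0 * c (lift i0 l)) ^+ q * e (lift i0 l) =
    c i0 ^+ q * (\sum_l a (lift i0 l) ^+ q * e (lift i0 l)) -
    a i0 ^+ q * \sum_l c (lift i0 l) ^+ q * e (lift i0 l).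
  rewrite !mulr_sumr -sumrB; apply: eq_bigr => l _.
  by rewrite frobB // !exprMn mulrBl -!mulrA.
by rewrite cE (bigD1_ord i0) //=; ring.
Qed.

(** The coefficient of a monomial is expanded in [u] modulo [M]; the error is a combination of the
    [x j] and raises the degree. Once an exponent reaches [q], the monomial goes into the second
    sum. *)
Lemma spanned_by_monomials d n (x : 'I_d -> A) (u : 'I_n -> A) (M : set A) :
  M = idealgen (range x) -> (forall y, spanned q M u y) -> forall a,
  exists (c : 'I_n * {ffun 'I_d -> 'I_q} -> A) (b : 'I_d -> A),
    a = \sum_i c i ^+ q * (u i.1 * \prod_j x j ^+ i.2 j) + \sum_j x j ^+ q * b j.
Proof.
move=> Mx spanu.
pose W := [set y | exists (c : 'I_n * {ffun 'I_d -> 'I_q} -> A) (b : 'I_d -> A),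
  y = \sum_i c i ^+ q * (u i.1 * \prod_j x j ^+ i.2 j) + \sum_j x j ^+ q * b j].
have W0 : W 0.
  exists (fun=> 0), (fun=> 0).
  by rewrite !big1 ?addr0 // => i _; rewrite ?mulr0 // frob0 // mul0r.
have WD y z : W y -> W z -> W (y + z).
  move=> [c [b ->]] [c' [b' ->]].
  exists (fun i => c i + c' i), (fun i => b i + b' i).
  under [in RHS]eq_bigr do rewrite frobD // mulrDl.
  under [X in _ = _ + X]eq_bigr do rewrite mulrDr.
  by rewrite !big_split /= addrACA.
have Wbig (beta : 'I_d -> nat) i a : (q <= beta i)%N -> W (a * \prod_j x j ^+ beta j).
  move=> qi; exists (fun=> 0), (fun j => if j == i then
     a * x i ^+ (beta i - q) * \prod_(l < d | l != i) x l ^+ beta l else 0).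
  rewrite [X in _ = X + _]big1 => [|l _]; last by rewrite frob0 // mul0r.
  rewrite (bigD1 i) //= [in RHS](bigD1 i) //= eqxx [X in _ = 0 + (_ + X)]big1.
    by rewrite -{1}(subnK qi) exprD; ring.
  by move=> l /negPf ->; rewrite mulr0.
(* [k] is the number of rounds left: [k] plus the degree stays above [d * q], so at [k = 0] some
   exponent is at least [q]. *)
suff Wmon k (beta : 'I_d -> nat) a : (d * q < k + \sum_j beta j)%N ->
    W (a * \prod_j x j ^+ beta j).
  move=> a; have := Wmon (d * q).+1 (fun=> 0) a.
  by rewrite big1 // big1 // mulr1 addn0; apply.
elim: k beta a => [|k IHk] beta a dk;
  (have [[i qi]|small] := pselect (exists i, (q <= beta i)%N); first exact: Wbig qi).
- exfalso; move: dk; rewrite add0n ltnNge => /negP; apply.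
  rewrite -[X in (X * _)%N]card_ord -sum_nat_const; apply: leq_sum => j _.
  by rewrite leqNgt; apply/negP => qj; apply: small; exists j; apply: ltnW.
- have bq j : (beta j < q)%N.
    by rewrite ltnNge; apply/negP => qj; apply: small; exists j.
  have [c Mc] := spanu a.
  have [y yE] : exists y : 'I_d -> A, a - \sum_i c i ^+ q * u i = \sum_j y j * x j.
    by apply: idealgen_rangeP; rewrite -Mx.
  rewrite -[a](subrK (\sum_i c i ^+ q * u i)) yE mulrDl !mulr_suml.
  apply: (WD); apply: (set_sum _ W0 WD) => i _.
    have -> : y i * x i * \prod_j x j ^+ beta j =
        y i * \prod_j x j ^+ (if j == i then (beta j).+1 else beta j).
      rewrite (bigD1 i) //= [in RHS](bigD1 i) //= eqxx exprS !mulrA; congr (_ * _).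
      by apply: eq_bigr => j /negPf ->.
    apply: IHk; apply: leq_trans dk _.
    rewrite addSnnS leq_add2l (bigD1 i) //= [leqRHS](bigD1 i) //= eqxx addSn ltnS leq_add2l.
    by apply: leq_sum => j /negPf ->.
  pose al := [ffun j => Ordinal (bq j)].
  exists (fun t => if t == (i, al) then c i else 0), (fun=> 0).
  rewrite [X in _ = _ + X]big1 => [|j _]; last by rewrite mulr0.
  rewrite (bigD1 (i, al)) //= eqxx [X in _ = _ + X + _]big1 => [|t /negPf ->]; last first.
    by rewrite frob0 // mul0r.
  by rewrite !addr0 mulrA; congr (_ * _); apply: eq_bigr => j _; rewrite ffunE.
Qed.

Theorem regular_local_basis : is_prime [set (0 : A)] -> regular_local A ->
  F_finite A q -> exists N (e : 'I_N -> A),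
    (forall x, exists c : 'I_N -> A, x = \sum_i c i ^+ q * e i) /\ indep q [set 0] e.
Proof.
move=> dom [noethA [M [Mmax uniqM [d [[[P chP] dimle] [x Mx]]]]]] Ffin.
have MP := maximal_prime Mmax; have [iM nM1 _] := MP.
have [Pp Pinc] := chP.
have unitM c : ~ M c -> exists c', c' * c = 1 by apply: local_unit noethA uniqM.
have inM X : is_prime X -> X `<=` M.
  move=> [iX nX1 _] c Xc; apply: contrapT => /unitM[c' c'c].
  by apply: nX1; rewrite -c'c; apply: idealMl.
(* The chain [P] has maximal length, so no prime can be inserted: it is saturated and runs from 0 to
   [M]. *)
have noins (X : set A) k : (k <= d.+1)%N -> is_prime X ->
    (forall i : 'I_d.+1, (i < k)%N -> P i `<` X) ->
    (forall i : 'I_d.+1, (k <= i)%N -> X `<` P i) -> False.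
  move=> kd Xp ltX gtX; have [P' /dimle] := prime_chain_insert kd chP Xp ltX gtX.
  by rewrite ltnn.
have Pmono (i j : 'I_d.+1) : (i <= j)%N -> P i `<=` P j.
  rewrite leq_eqVlt => /predU1P[/val_inj -> //|/Pinc[]//].
have P0 : P ord0 = [set 0].
  apply/seteqP; split=> [|_ ->]; last by case: (Pp ord0) => -[].
  apply: contrapT => nP0; apply: (noins [set 0] 0) => // i _; split.
    by move=> _ ->; case: (Pp i) => -[].
  by move=> Pi0; apply: nP0; apply: subset_trans Pi0; apply: Pmono.
have PM : P ord_max = M.
  apply/seteqP; split; first exact: inM.
  apply: contrapT => nPM; apply: (noins M d.+1) => // i; last by rewrite leqNgt ltn_ord.
  move=> _; split; first exact: inM.
  by move=> MPi; apply: nPM; apply: subset_trans MPi _; apply: Pmono; rewrite -ltnS.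
have [n [u [indu _ spanu]]] := indep_max chq Ffin MP.
(* Descent from [M]: each next smaller prime of the chain multiplies the size of the independent
   family by [q]. *)
have ind k : (k <= d)%N ->
    exists w : 'I_(q ^ k * n) -> A, indep q (P (inord (d - k))) w.
  elim: k => [|k IHk] kd.
    have -> : inord (d - 0) = ord_max :> 'I_d.+1 by apply: val_inj; rewrite /= subn0 inordK.
    by rewrite PM expn0 mul1n; exists u.
  have [w indw] := IHk (ltnW kd).
  set j := inord _ in indw; pose i : 'I_d.+1 := inord (d - k.+1).
  have jE : j = (d - k)%N :> nat by rewrite inordK // ltnS leq_subr.
  have iE : i = (d - k.+1)%N :> nat by rewrite inordK // ltnS leq_subr.
  have ij : j = i.+1 :> nat by rewrite jE iE -subSn // subSS.
  have [|PiPj nPji] := Pinc i j; first by rewrite ij.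
  have [|w' indw'] := indep_adjacent (Pp i) (Pp j) PiPj noethA _ chq Ffin nPji indw.
    move=> I Ip PiI IPj; apply: contrapT => /not_orP[nI nIj].
    apply: (noins I j) => //; first exact: ltnW.
    - move=> l lj; split; first by apply: subset_trans PiI; apply: Pmono; rewrite -ltnS -ij.
      move=> IPl; apply: nI; apply: subset_trans IPl _; apply: Pmono.
      by rewrite -ltnS -ij.
    - move=> l jl; split; first by apply: subset_trans IPj _; apply: Pmono.
      by move=> PlI; apply: nIj; apply: subset_trans PlI; apply: Pmono.
  by rewrite expnS -mulnA; exists w'.
have {ind}[w] := ind d (leqnn d).
have -> : inord (d - d) = ord0 :> 'I_d.+1 by apply: val_inj; rewrite /= subnn inordK.
rewrite P0 => indw.
have spanM y : spanned q M u y.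
  have [t /unitM[t' t't] [c Mc]] := spanu y.
  exists (fun i => t' * c i).
  have -> : y - \sum_i (t' * c i) ^+ q * u i = t' ^+ q * (t ^+ q * y - \sum_i c i ^+ q * u i).
    rewrite mulrBr mulrA -exprMn t't expr1n mul1r mulr_sumr; congr (_ - _).
    by apply: eq_bigr => i _; rewrite exprMn mulrA.
  exact: idealMl.
have mon := spanned_by_monomials Mx spanM.
pose I := ('I_n * {ffun 'I_d -> 'I_q})%type.
pose e (i : 'I_#|{: I}|) := u (enum_val i).1 * \prod_j x j ^+ (enum_val i).2 j.
pose T := [set y | exists c : 'I_#|{: I}| -> A, y = \sum_i c i ^+ q * e i].
have Tmod : premod [set 0] q T.
  split.
  - by move=> _ ->; exists (fun=> 0); rewrite big1 // => i _; rewrite frob0 // mul0r.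
  - move=> _ _ [c ->] [c' ->]; exists (fun i => c i + c' i); rewrite -big_split.
    by apply: eq_bigr => i _; rewrite frobD // mulrDl.
  - move=> a _ [c ->]; exists (fun i => a * c i); rewrite mulr_sumr.
    by apply: eq_bigr => i _; rewrite exprMn mulrA.
have spane y : T y.
  have [k [s spans]] := Ffin.
  have [c ->] := spans y.
  have [T0 TD TM] := Tmod.
  apply: (set_sum _ _ TD) => [|i0 _]; [exact: T0 | apply: TM].
  (* The remainder [x i ^+ q * b i] is rewritten in the generators [s] by expanding [b i]; the
     factor [x i] puts the new coefficients in [M]. *)
  apply: (nakayama iM (M := M)) => // [m Mm|j].
    apply: unitM => M1; apply: nM1; rewrite -[1](subrK m); exact: idealD.
  have [c' [b sE]] := mon (s j).
  have [a aE] := choice (fun i => spans (b i)).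
  exists (fun l => \sum_i x i * a i l) => [l|].
    apply: ideal_sum => // i _; apply: idealMr => //.
    by rewrite Mx; apply: idealgen_sub; exists i.
  exists (fun i => c' (enum_val i)).
  have -> : \sum_l (\sum_i x i * a i l) ^+ q * s l = \sum_i x i ^+ q * b i.
    under eq_bigr do rewrite frob_sum // mulr_suml.
    rewrite exchange_big; apply: eq_bigr => i _; rewrite (aE i) mulr_sumr.
    by apply: eq_bigr => l _; rewrite exprMn mulrA.
  rewrite sE addrK [LHS](reindex (@enum_val _ {: I})) //=.
  exact: onW_bij (enum_val_bij _).
(* The spanning family is no larger than the independent one, which forces it to be a basis. *)
have cardI : (#|{: I}| <= q ^ d * n)%N.
  by rewrite card_prod card_ffun !card_ord mulnC.
have [w' indw'] := indep_leq chq dom cardI indw.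
by exists #|{: I}|, e; split=> //; apply: basis_of_span indw'.
Qed.

End LocalBasis.

(** * Passing to localizations *)

Lemma pchar_natX (A : comNzRingType) p e : p \in [pchar A] -> [pchar A].-nat (p ^ e)%N.
Proof. by move=> pA; rewrite pnatX /pnat prime_gt0 ?(pcharf_prime pA) //= primes_prime ?(pcharf_prime pA) //= pA. Qed.

Lemma F_finite_fin (A : comNzRingType) q (I : finType) (s : I -> A) :
  (forall x, exists c : I -> A, x = \sum_i c i ^+ q * s i) -> F_finite A q.
Proof.
move=> spans; exists #|I|, (fun i => s (enum_val i)) => x.
have [c ->] := spans x; exists (fun i => c (enum_val i)).
rewrite (reindex (@enum_val _ I)) //=.
exact: onW_bij (enum_val_bij _).
Qed.

Lemma F_finiteX (A : comNzRingType) p e : p \in [pchar A] -> F_finite A p ->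
  F_finite A (p ^ e).
Proof.
move=> pA [n [s spans]]; have chp : [pchar A].-nat p by rewrite -[p]expn1 pchar_natX.
elim: e => [|e [m [t spant]]].
  by exists 1, (fun=> 1) => x; exists (fun=> x); rewrite big_ord1 mulr1.
apply: (@F_finite_fin _ _ _ (fun i : 'I_n * 'I_m => s i.1 * t i.2 ^+ p)) => x.
have [c ->] := spans x; have [d cE] := choice (fun i => spant (c i)).
exists (fun i => d i.1 i.2).
rewrite -(pair_bigA _ (fun i j => d i j ^+ (p ^ e.+1) * (s i * t j ^+ p))) /=.
apply: eq_bigr => i _; rewrite {1}(cE i) frob_sum // mulr_suml.
by apply: eq_bigr => j _; rewrite exprMn -exprM -expnSr; ring.
Qed.

Section Localize.
Variables (R : idomainType) (P : primeIdeal R).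
Let M := prime_set P.
Let A := localization P.

Fact frac_subproof (a s : R) : ~ M s -> tofrac a / tofrac s \in loc_pred P.
Proof. by move=> ns; apply/loc_predP; exists a, s. Qed.

Definition loc_frac a s (ns : ~ M s) : A := Localization (frac_subproof a ns).

Lemma loc_fracE (x : A) : exists a s, ~ M s /\ val x = tofrac a / tofrac s.
Proof. by case: x => x xP /=; apply/loc_predP. Qed.

Lemma prime_not1 : ~ M 1. Proof. by case: (prime_setP P). Qed.

Lemma prime_prod (I : finType) (w : I -> R) (D : pred I) :
  (forall i, ~ M (w i)) -> ~ M (\prod_(i | D i) w i).
Proof.
by move=> nw; apply: (big_ind (fun u => ~ M u)) => //;
  [exact: prime_not1 | exact: prime_denomM].
Qed.

Lemma common_denominator n (z : 'I_n -> A) : exists2 u, ~ M u &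
  exists b : 'I_n -> R, forall i, tofrac u * val (z i) = tofrac (b i).
Proof.
have [a aP] := choice (fun i => loc_fracE (z i)); have [s sP] := choice aP.
exists (\prod_i s i); first by apply: prime_prod => i; case: (sP i).
exists (fun i => a i * \prod_(j | j != i) s j) => i.
have [/prime_denom_neq0 s0 ->] := sP i.
by rewrite (bigD1 i) //= !tofracM; field.
Qed.

Lemma localization_domain : is_prime [set (0 : A)].
Proof.
split=> [|/eqP|x y /= /(congr1 val)].
- by split=> [|_ _ -> ->|r _ ->] //=; rewrite ?addr0 ?mulr0.
- by rewrite oner_eq0.
- rewrite rmorphM rmorph0 => /eqP; rewrite mulf_eq0 => /orP[] /eqP v0; [left|right];
  by apply: val_inj; rewrite v0 rmorph0.
Qed.

Lemma localization_pchar p : p \in [pchar R] -> p \in [pchar A].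
Proof.
move=> pR; rewrite inE (pcharf_prime pR) /=; apply/eqP; apply: val_inj.
by rewrite rmorph_nat rmorph0 -(rmorph_nat (@tofrac R)) (pcharf0 pR) rmorph0.
Qed.

Lemma localization_F_finite q : (0 < q)%N -> F_finite R q -> F_finite A q.
Proof.
move=> q0 [n [s spans]]; exists n, (fun i => loc_frac (s i) prime_not1) => x.
have [a [t [nt xE]]] := loc_fracE x.
(* [a / t] is written as [a t^(q-1) / t^q], with a [q]-th power as denominator. *)
have [c cE] := spans (a * t ^+ q.-1).
exists (fun i => loc_frac (c i) nt); apply: val_inj.
rewrite rmorph_sum.
rewrite xE.
have t0 := prime_denom_neq0 nt.
have -> : tofrac a / tofrac t = tofrac (a * t ^+ q.-1) / tofrac t ^+ q.
  rewrite tofracM tofracXn -{2}(prednK q0) exprS.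
  by rewrite invfM mulrACA divff ?mulr1 // expf_neq0.
rewrite cE.
rewrite (raddf_sum (@tofrac R)) mulr_suml.
apply: eq_bigr => i _.
rewrite rmorphM rmorphXn.
by rewrite /= tofrac1 divr1 tofracM tofracXn expr_div_n mulrAC.
Qed.
Theorem regular_basis p q : p \in [pchar R] -> [pchar R].-nat q ->
  regular_local A -> F_finite R q -> exists N (e : 'I_N -> R),
    (forall x, exists2 u, ~ M u &
       exists c : 'I_N -> R, u ^+ q * x = \sum_i c i ^+ q * e i) /\
    indep q [set 0] e.
Proof.
move=> pR chq regA Ffin; have q_gt0 := pchar_nat_gt0 chq.
have chqA : [pchar A].-nat q.
  by apply: sub_in_pnat chq => l _; apply: localization_pchar.
have [N [e [spane inde]]] := regular_local_basis chqA localization_domain regA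
  (localization_F_finite q_gt0 Ffin).
have [a aP] := choice (fun i => loc_fracE (e i)); have [t tP] := choice aP.
have nt i : ~ M (t i) by case: (tP i).
have eE i : val (e i) = tofrac (a i) / tofrac (t i) by case: (tP i).
have t0 i : tofrac (t i) != 0 by apply: prime_denom_neq0 (nt i).
(* This is [t i ^+ q * e i]: rescaling by [q]-th powers moves the basis into [R] and preserves
   independence. *)
pose e' i := a i * t i ^+ q.-1.
have e'E i : tofrac (e' i) = tofrac (t i) ^+ q * val (e i).
  rewrite eE /e' tofracM tofracXn -{2}(prednK q_gt0) exprS.
  by rewrite [tofrac (a i) / _]mulrC mulrACA divff // mul1r mulrC.
exists N, e'; split=> [x|c /= ce i].
- have [c xE] := spane (loc_frac x prime_not1).
  pose z i := c i * loc_frac 1 (nt i).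
  have zE i : val (z i) = val (c i) / tofrac (t i).
    by rewrite /z rmorphM /= tofrac1 div1r.
  have [u nu [b bE]] := common_denominator z.
  exists u => //; exists b; apply/eqP; rewrite -tofrac_eq; apply/eqP.
  rewrite (raddf_sum (@tofrac R)) tofracM tofracXn.
  have -> : tofrac x = \sum_i val (c i) ^+ q * val (e i).
    have -> : tofrac x = val (loc_frac x prime_not1) by rewrite /= tofrac1 divr1.
    rewrite xE rmorph_sum.
    by apply: eq_bigr => i _; rewrite rmorphM rmorphXn.
  rewrite mulr_sumr; apply: eq_bigr => i _.
  rewrite [RHS]tofracM tofracXn -bE zE e'E !exprMn exprVn -!mulrA.
  by congr (_ * (_ * _)); rewrite mulKf // expf_neq0.
- have c0 : \sum_i (loc_frac (c i * t i) prime_not1) ^+ q * e i = 0.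
    apply: val_inj; rewrite rmorph_sum rmorph0.
    transitivity (tofrac (\sum_i c i ^+ q * e' i)); last by rewrite ce tofrac0.
    rewrite (raddf_sum (@tofrac R)); apply: eq_bigr => j _.
    rewrite rmorphM rmorphXn /= tofrac1 divr1 [RHS]tofracM e'E.
    by rewrite tofracM tofracXn exprMn mulrA.
  have /(congr1 val) /= := inde _ c0 i.
  rewrite tofrac1 divr1 => /eqP.
  rewrite tofrac_eq0 mulf_eq0 => /orP[/eqP //|].
  by rewrite -tofrac_eq0 (negPf (t0 i)).
Qed.

End Localize.

(** * Coefficients of polynomials and Frobenius powers *)

Section Coefficients.
Variables (n : nat) (R : comNzRingType).
Implicit Types (f h : {mpoly R[n]}) (I J : set R) (q : nat).

Definition coefs_in I := [set f : {mpoly R[n]} | forall m, I f@_m].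

Definition content f := idealgen (range (fun m => f@_m)).

Definition small_exponents q (m : 'X_{1..n}) := forall j, (m j < q)%N.

Lemma content_ideal f : is_ideal (content f).
Proof. exact: idealgen_ideal. Qed.

Lemma content_coef f m : content f f@_m.
Proof. by apply: idealgen_sub; exists m. Qed.

Lemma content1 x : content 1 x.
Proof.
rewrite -[x]mulr1; apply: (idealMl _ (content_ideal 1)).
by have := @content_coef 1 0%MM; rewrite mcoeff1 eqxx.
Qed.

Lemma coefs_in_ideal I : is_ideal I -> is_ideal (coefs_in I).
Proof.
move=> iI; split=> [m|f h If Ih m|r f If m].
- by rewrite mcoeff0; apply: ideal0.
- by rewrite mcoeffD; apply: idealD.
- by rewrite mcoeffM; apply: ideal_sum => // k _; apply: idealMl.
Qed.

Lemma coefs_inM I J f h : coefs_in I f -> coefs_in J h -> coefs_in (idealM I J) (f * h).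
Proof.
move=> If Jh m; rewrite mcoeffM; apply: ideal_sum; first exact: idealM_ideal.
by move=> k _; apply: idealM_in.
Qed.

Lemma coefs_inX I f k : coefs_in I f -> coefs_in (idealX I k) (f ^+ k).
Proof.
by move=> If; elim: k => [//|k IHk]; rewrite exprS; apply: coefs_inM.
Qed.

Lemma mpoly_pchar p : p \in [pchar R] -> p \in [pchar {mpoly R[n]}].
Proof.
move=> pR; rewrite inE (pcharf_prime pR) /=.
by rewrite -(rmorph_nat (@mpolyC n R)) (pcharf0 pR) rmorph0.
Qed.

Lemma frob_mpolyE q h : [pchar {mpoly R[n]}].-nat q ->
  h ^+ q = \sum_(m <- msupp h) (h@_m ^+ q) *: 'X_[(m *+ q)].
Proof.
move=> chq; rewrite {1}[h]mpolyE frob_sum //; apply: eq_bigr => m _.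
by rewrite exprZn mpolyXn.
Qed.

Lemma coefs_in_frob I f q : [pchar {mpoly R[n]}].-nat q ->
  coefs_in I f -> coefs_in (frob_pow I q) (f ^+ q).
Proof.
move=> chq If m; rewrite frob_mpolyE // raddf_sum.
apply: ideal_sum => [|k _ /=]; first exact: frob_pow_ideal.
rewrite mcoeffZ; apply: (idealMr _ (frob_pow_ideal I q)).
by apply: idealgen_sub; exists f@_k.
Qed.

(** The constants in the target form an ideal of [R] that contains the [q]-th powers from [I], hence
    every coefficient of [f]. *)
Lemma frob_pow_coefs I f q : is_ideal I ->
  coefs_in (frob_pow I q) f -> frob_pow (coefs_in I) q f.
Proof.
move=> iI If; rewrite [f]mpolyE; apply: ideal_sum; first exact: frob_pow_ideal.
move=> m _; rewrite -mul_mpolyC; apply: (idealMr _ (frob_pow_ideal _ q)).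
have iF := frob_pow_ideal (coefs_in I) q.
have iC : is_ideal [set c : R | frob_pow (coefs_in I) q c%:MP].
  split=> [|x y Fx Fy|r x Fx] /=.
  - by rewrite rmorph0; apply: (ideal0 iF).
  - by rewrite rmorphD; apply: (idealD iF).
  - by rewrite rmorphM; apply: (idealMl _ iF).
apply: (idealgen_min iC _ (If m)) => _ [x Ix <-] /=.
rewrite rmorphXn; apply: idealgen_sub; exists x%:MP => //= k.
by rewrite mcoeffC; apply: idealMr.
Qed.

Lemma mcoeff_sum_supp f m0 :
  f@_m0 = \sum_(m <- msupp f) f@_m * (m == m0)%:R.
Proof.
rewrite {1}[f]mpolyE raddf_sum; apply: eq_bigr => m _ /=.
by rewrite mcoeffZ mcoeffX.
Qed.

(** By division with remainder in each exponent, [b + c *+ q] determines [c] and the small [b], so a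
    single pair of terms contributes. *)
Lemma mcoeff_mul_frob q f h b c : [pchar R].-nat q -> [pchar {mpoly R[n]}].-nat q ->
  (forall m, f@_m != 0 -> small_exponents q m) -> small_exponents q b ->
  (f * h ^+ q)@_(b + c *+ q) = f@_b * h@_c ^+ q.
Proof.
move=> chR chq smallf smallb; have q_gt0 := pchar_nat_gt0 chq.
rewrite frob_mpolyE // {1}[f]mpolyE mulr_suml raddf_sum /=.
rewrite [X in _ = X * _]mcoeff_sum_supp [X in _ = _ * X ^+ q]mcoeff_sum_supp.
rewrite frob_sum // mulr_suml !big_seq; apply: eq_bigr => m mf.
have smallm : small_exponents q m by apply: smallf; rewrite -mcoeff_msupp.
rewrite !mulr_sumr raddf_sum /=; apply: eq_bigr => d _.
rewrite -scalerAl -scalerAr -mpolyXD !mcoeffZ mcoeffX exprMn.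
have -> : (m + d *+ q == b + c *+ q)%MM = (m == b) && (d == c).
  apply/eqP/andP => [/mnmP E|[/eqP -> /eqP ->]] //.
  split; apply/eqP/mnmP => j; have := E j; rewrite !mnmDE !mulmnE => Ej.
  - have := congr1 (modn^~ q) Ej; 
    by rewrite /= ![(_ + _ * _)%N]addnC !modnMDl !modn_small.
  - have := congr1 (divn^~ q) Ej.
    by rewrite /= ![(_ + _ * _)%N]addnC !divnMDl // !divn_small // !addn0.
by case: (m == b); case: (d == c); rewrite /= ?expr1n ?frob0 // ?(mulr0, mul0r, mulr1).
Qed.

(** The products of a coefficient of [f] and a [q]-th power of a coefficient of [h] are coefficients
    of [f * h ^+ q], and they generate the left side by additivity of [q]-th powers. *)
Lemma content_mul_frob q f h : [pchar R].-nat q -> [pchar {mpoly R[n]}].-nat q ->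
  (forall m, f@_m != 0 -> small_exponents q m) ->
  idealM (content f) (frob_pow (content h) q) `<=` content (f * h ^+ q).
Proof.
move=> chR chq smallf; set D := content (f * h ^+ q).
have iD : is_ideal D by apply: content_ideal.
apply: (idealM_min iD) => x y fx hy.
have iDx : is_ideal [set x | D (x * y)].
  split=> [|u v Du Dv|r u Du] /=.
  - by rewrite mul0r; apply: (ideal0 iD).
  - by rewrite mulrDl; apply: (idealD iD).
  - by rewrite -mulrA; apply: (idealMl _ iD).
apply: (idealgen_min iDx _ fx) => _ [b _ <-] /= {x fx iDx}.
have [->|fb0] := eqVneq f@_b 0; first by rewrite mul0r; apply: (ideal0 iD).
have iDy : is_ideal [set y | D (f@_b * y)].
  split=> [|u v Du Dv|r u Du] /=.
  - by rewrite mulr0; apply: (ideal0 iD).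
  - by rewrite mulrDr; apply: (idealD iD).
  - by rewrite mulrCA; apply: (idealMl _ iD).
apply: (idealgen_min iDy _ hy) => _ [z hz <-] {y hy iDy} /=.
have iDz : is_ideal [set z | D (f@_b * z ^+ q)].
  split=> [|u v Du Dv|r u Du] /=.
  - by rewrite frob0 // mulr0; apply: (ideal0 iD).
  - by rewrite frobD // mulrDr; apply: (idealD iD).
  - by rewrite exprMn mulrCA; apply: (idealMl _ iD).
apply: (idealgen_min iDz _ hz) => _ [c _ <-] /= {z hz iDz}.
rewrite -mcoeff_mul_frob //; first exact: content_coef.
exact: smallf.
Qed.

Lemma big_idealM_sub L (I : 'I_L -> set R) i : (forall i, is_ideal (I i)) ->
  \big[@idealM R/setT]_(i < L) I i `<=` I i.
Proof.
elim: L I i => [|L IHL] I i iI; first by case: i.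
rewrite big_ord_recl; apply: (idealM_min (iI i)) => x y Ix Iy.
case: (unliftP ord0 i) => [j|] ->; last exact: (idealMr _ (iI ord0)).
by apply: (idealMl _ (iI _)); apply: (IHL (fun j => I (lift ord0 j))).
Qed.

Lemma frob_pow_mono I J q : I `<=` J -> frob_pow I q `<=` frob_pow J q.
Proof.
move=> IJ; apply: idealgen_min; first exact: frob_pow_ideal.
by move=> _ [x /IJ Jx <-]; apply: idealgen_sub; exists x.
Qed.

Lemma idealM_mono I I' J J' : I `<=` I' -> J `<=` J' -> idealM I J `<=` idealM I' J'.
Proof.
move=> II' JJ'; apply: idealM_min; first exact: idealM_ideal.
by move=> x y /II' Ix /JJ' Jy; apply: idealM_in.
Qed.

Lemma frob_pow_idealM I J q : 
  idealM (frob_pow I q) (frob_pow J q) `<=` frob_pow (idealM I J) q.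
Proof.
have iF := frob_pow_ideal (idealM I J) q.
apply: (idealM_min iF) => x y Ix Jy.
have iFx : is_ideal [set x | frob_pow (idealM I J) q (x * y)].
  split=> [|u v Du Dv|r u Du] /=.
  - by rewrite mul0r; apply: (ideal0 iF).
  - by rewrite mulrDl; apply: (idealD iF).
  - by rewrite -mulrA; apply: (idealMl _ iF).
apply: (idealgen_min iFx _ Ix) => _ [u Iu <-] /= {x Ix iFx}.
have iFy : is_ideal [set y | frob_pow (idealM I J) q (u ^+ q * y)].
  split=> [|v w Du Dv|r v Du] /=.
  - by rewrite mulr0; apply: (ideal0 iF).
  - by rewrite mulrDr; apply: (idealD iF).
  - by rewrite mulrCA; apply: (idealMl _ iF).
apply: (idealgen_min iFy _ Jy) => _ [v Jv <-] /= {y Jy iFy}.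
rewrite -exprMn; apply: idealgen_sub; exists (u * v) => //.
exact: idealM_in.
Qed.

Lemma frob_pow_frob I q q' : frob_pow I (q * q') `<=` frob_pow (frob_pow I q) q'.
Proof.
apply: idealgen_min; first exact: frob_pow_ideal.
move=> _ [x Ix <-]; apply: idealgen_sub; exists (x ^+ q); last by rewrite exprM.
by apply: idealgen_sub; exists x.
Qed.

Lemma frob_pow_big L (I : 'I_L -> set R) (q : 'I_L -> nat) q' :
  \big[@idealM R/setT]_(i < L) frob_pow (I i) (q i * q')
  `<=` frob_pow (\big[@idealM R/setT]_(i < L) frob_pow (I i) (q i)) q'.
Proof.
elim: L I q => [|L IHL] I q.
  rewrite !big_ord0 => x _; rewrite -[x]mulr1.
  apply: (idealMl _ (frob_pow_ideal _ _)); apply: idealgen_sub.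
  by exists 1; rewrite ?expr1n.
rewrite !big_ord_recl; apply: (subset_trans _ (@frob_pow_idealM _ _ _)).
by apply: idealM_mono; [exact: frob_pow_frob | exact: IHL].
Qed.

(** Induction on the digits: beyond the lowest one, the factors form a [p]-th power [h ^+ p], to
    which [content_mul_frob] applies. *)
Lemma content_digits p L (I : 'I_L -> set R) (f : 'I_L -> {mpoly R[n]}) :
  p \in [pchar R] -> (forall i, I i `<=` content (f i)) ->
  (forall i m, (f i)@_m != 0 -> small_exponents p m) ->
  \big[@idealM R/setT]_(i < L) frob_pow (I i) (p ^ i)
  `<=` content (\prod_(i < L) f i ^+ (p ^ i)).
Proof.
move=> pR; have chR : [pchar R].-nat p by rewrite -[p]expn1 pchar_natX.
have chp : [pchar {mpoly R[n]}].-nat p by rewrite -[p]expn1 pchar_natX // mpoly_pchar.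
elim: L I f => [|L IHL] I f If smallf.
  by rewrite !big_ord0 => x _; apply: content1.
rewrite !big_ord_recl /= expn0.
pose h := \prod_(i < L) f (lift ord0 i) ^+ (p ^ i).
have -> : \prod_(i < L) f (lift ord0 i) ^+ (p ^ bump 0 i) = h ^+ p.
  by rewrite -prodrXl; apply: eq_bigr => i _; rewrite -exprM -expnSr.
rewrite expr1; apply: (subset_trans _ (content_mul_frob chR chp (smallf ord0))).
apply: idealM_mono.
  apply: idealgen_min; first exact: content_ideal.
  by move=> _ [x Ix <-]; rewrite expr1; apply: If.
have -> : \big[@idealM R/setT]_(i < L) frob_pow (I (lift ord0 i)) (p ^ bump 0 i) =
  \big[@idealM R/setT]_(i < L) frob_pow (I (lift ord0 i)) (p ^ i * p).
  by apply: eq_bigr => i _; rewrite -expnSr.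
apply: (subset_trans (@frob_pow_big _ _ _ _)); apply: frob_pow_mono.
by apply: IHL => i; [exact: If | exact: smallf].
Qed.

End Coefficients.

Lemma base_expansion p k L : (0 < p)%N -> (k < p ^ L)%N ->
  k = (\sum_(i < L) (k %/ p ^ i %% p) * p ^ i)%N.
Proof.
move=> p0; elim: L k => [|L IHL] k; first by rewrite expn0 ltnS leqn0 big_ord0 => /eqP.
rewrite expnSr => kL; rewrite big_ord_recl /= expn0 divn1 muln1.
rewrite {1}(divn_eq k p) addnC; congr (_ + _)%N.
rewrite {1}(IHL (k %/ p)%N) ?ltn_divLR // big_distrl /=.
by apply: eq_bigr => i _; rewrite -divnMA -expnS -mulnA -expnSr.
Qed.

Lemma pchar_natr_inverse (R : comNzRingType) p k : p \in [pchar R] ->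
  (0 < k < p)%N -> exists d : R, d * k%:R = 1.
Proof.
move=> pR /andP[k0 kp]; have pp := pcharf_prime pR.
have [a _] := Bezoutl k (prime_gt0 pp).
have /eqP -> : coprime p k by rewrite prime_coprime // gtnNdvd.
rewrite (dvdn_pcharf pR) natrD natrM => /eqP E.
by exists (- a%:R); rewrite mulNr; apply/eqP; rewrite eq_sym -addr_eq0 E.
Qed.

(** * Coordinates of polynomials over the q-th powers *)

Section FrobeniusPowerOfPolynomialIdeal.
Variables (n : nat) (R : comNzRingType) (q N : nat) (M : set R) (e : 'I_N -> R).
Hypotheses (chR : [pchar R].-nat q) (chS : [pchar {mpoly R[n]}].-nat q).
Hypothesis Mmax : is_maximal M.
Hypothesis spane : forall x, exists2 u, ~ M u &
  exists c : 'I_N -> R, u ^+ q * x = \sum_i c i ^+ q * e i.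
Hypothesis inde : indep q [set 0] e.
Variable c : set {mpoly R[n]}.
Hypothesis ic : is_ideal c.

Let MP : is_prime M := maximal_prime Mmax.

(* Near M, the products of e i and a monomial of small exponent b form a basis
   of R[z] over its q-th powers; w lists the coordinates of f along b. *)
Definition local_coordinates (f : {mpoly R[n]}) := forall b, small_exponents q b ->
  exists2 u, ~ M u & exists2 w : 'I_N -> {mpoly R[n]}, (forall i, c (w i)) &
  forall d, u ^+ q * f@_(b + d *+ q) = \sum_i (w i)@_d ^+ q * e i.

Lemma local_coordinates0 : local_coordinates 0.
Proof.
move=> b _; exists 1; first by case: MP.
exists (fun=> 0) => [_|d]; first exact: ideal0.
by rewrite mcoeff0 mulr0 big1 // => i _; rewrite mcoeff0 frob0 // mul0r.
Qed.

Lemma local_coordinatesD f h :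
  local_coordinates f -> local_coordinates h -> local_coordinates (f + h).
Proof.
move=> fP hP b sb; have [u nu [w cw wE]] := fP b sb; have [v nv [z cz zE]] := hP b sb.
exists (u * v); first by case: MP => _ _ Mmul /Mmul[].
exists (fun i => v%:MP * w i + u%:MP * z i) => [i|d].
  by apply: idealD => //; apply: idealMl.
under eq_bigr do rewrite mcoeffD !mcoeffCM frobD // !exprMn mulrDl -!mulrA.
by rewrite big_split /= -!mulr_sumr -wE -zE mcoeffD exprMn; ring.
Qed.

Lemma local_coordinates_frob r y : c y -> local_coordinates (r * y ^+ q).
Proof.
move=> cy; have q_gt0 := pchar_nat_gt0 chR.
rewrite [r]mpolyE mulr_suml.
apply: (set_sum _ local_coordinates0 local_coordinatesD) => m _ b sb.
(* Dividing the exponents by [q] turns the term into a coefficient times [X^m0 (X^m1 y)^q]: only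
   [b = m0] sees it, and its coordinates are multiples of [y], hence in [c]. *)
pose m0 := [multinom (m j %% q)%N | j < n].
pose m1 := [multinom (m j %/ q)%N | j < n].
have mE : m = (m0 + m1 *+ q)%MM.
  by apply/mnmP => j; rewrite mnmDE mulmnE !mnmE addnC -divn_eq.
have coefE d : ((r@_m *: 'X_[m]) * y ^+ q)@_(b + d *+ q) =
    r@_m * (m0 == b)%:R * ('X_[m1] * y)@_d ^+ q.
  have -> : 'X_[m] = 'X_[m0] * 'X_[m1] ^+ q :> {mpoly R[n]}.
    by rewrite mpolyXn -mpolyXD -mE.
  rewrite scalerAl -[X in X@__ = _]mulrA -exprMn mcoeff_mul_frob //.
    by rewrite mcoeffZ mcoeffX.
  move=> l; rewrite mcoeffZ mcoeffX; case: (m0 =P l) => [<- _ j|_]; last by rewrite mulr0 eqxx.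
  by rewrite mnmE ltn_mod.
have [u nu [a aE]] := spane r@_m.
exists u => //.
exists (fun i => (if m0 == b then a i else 0)%:MP * ('X_[m1] * y)) => [i|d].
  by apply: idealMl => //; apply: idealMl.
rewrite coefE; under eq_bigr do rewrite mcoeffCM exprMn mulrAC.
rewrite -mulr_suml !mulrA aE; congr (_ * _).
case: (m0 == b); first by rewrite mulr1.
by rewrite mulr0 big1 // => i _; rewrite frob0 // mul0r.
Qed.

Lemma frob_pow_local_coordinates f : frob_pow c q f -> local_coordinates f.
Proof.
(* The multiplier [r] is built in so that the set is visibly an ideal. *)
move=> cf; suff : [set f | forall r, local_coordinates (r * f)] f.
  by move=> /(_ 1); rewrite mul1r.
apply: idealgen_min cf => [|_ [y cy <-] r /=]; last exact: local_coordinates_frob.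
split=> /= [r|f1 f2 H1 H2 r|r f1 H1 r'].
- by rewrite mulr0; apply: local_coordinates0.
- by rewrite mulrDr; apply: local_coordinatesD.
- by rewrite mulrA.
Qed.

(** Small exponents make the coefficients at [b + d *+ q] vanish for nonzero [d], so by independence
    the coordinates are constants. These lie in [c], hence in [M]. *)
Lemma frob_pow_coef f : (forall m, f@_m != 0 -> small_exponents q m) ->
  (forall x, c x%:MP -> M x) -> frob_pow c q f -> coefs_in (frob_pow M q) f.
Proof.
move=> smallf cM /frob_pow_local_coordinates fP b.
have iF := frob_pow_ideal M q.
have [->|/smallf sb] := eqVneq f@_b 0; first exact: (ideal0 iF).
have [u nu [w cw wE]] := fP b sb.
have wC i : w i = ((w i)@_0%MM)%:MP.
  apply/mpolyP => d; rewrite mcoeffC.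
  have [->|d0] := eqVneq d 0%MM; first by rewrite mulr1.
  rewrite mulr0; apply: (inde (c := fun i => (w i)@_d)) => /=.
  rewrite -wE; suff -> : f@_(b + d *+ q) = 0 by rewrite mulr0.
  apply/eqP; apply: contraNT d0 => /smallf sbd; apply/eqP/mnmP => j.
  have := sbd j; rewrite mnmDE mulmnE mnm0E; case: (d j) => // k.
  by rewrite mulSn addnCA ltnNge leq_addr.
have Fu : frob_pow M q (u ^+ q * f@_b).
  have := wE 0%MM.
  have -> : (b + 0%MM *+ q)%MM = b by apply/mnmP => j; rewrite mnmDE mulmnE mnm0E addn0.
  move=> ->; apply: (ideal_sum _ iF) => i _; apply: (idealMr _ iF).
  by apply: idealgen_sub; exists (w i)@_0%MM => //; apply: cM; rewrite -wC.
(* [u] is invertible modulo [M], and [1 = (1 - v u)^q + (v u)^q] removes the factor [u ^+ q]. *)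
have [v Mv] := maximal_inverse Mmax nu.
have -> : f@_b = f@_b * (1 - v * u) ^+ q + v ^+ q * (u ^+ q * f@_b).
  by rewrite frobB // expr1n exprMn; ring.
apply: (idealD iF); last exact: (idealMl _ iF).
by apply: (idealMl _ iF); apply: idealgen_sub; exists (1 - v * u).
Qed.

End FrobeniusPowerOfPolynomialIdeal.

(** * The generic linear combination *)

Section GenericCombination.
Variables (m : nat) (R : comNzRingType) (g : 'I_m -> R) (p : nat).
Hypothesis pR : p \in [pchar R].

Let a := idealgen (range g).
Let G : {mpoly R[m]} := \sum_(i < m) 'X_i * (g i)%:MP.
Let pp : prime p := pcharf_prime pR.

Lemma generic_coefs : coefs_in a G.
Proof.
have ia : is_ideal a by apply: idealgen_ideal.
have ica := coefs_in_ideal m ia.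
apply: (ideal_sum _ ica) => i _; apply: (idealMl _ ica) => k.
by rewrite mcoeffC; apply: (idealMr _ ia); apply: idealgen_sub; exists i.
Qed.

Lemma generic_exponents k (u : 'X_{1..m}) : (G ^+ k)@_u != 0 ->
  forall j, (u j <= k)%N.
Proof.
move=> Gu j; have homG : G \is 1.-homog.
  apply: rpred_sum => i _; rewrite mulrC mul_mpolyC; apply: rpredZ.
  by rewrite dhomogX /= mdeg1.
have := dhomogMn k homG; rewrite mul1n => homGk.
have -> : k = mdeg u.
  apply/eqP; rewrite eq_sym; apply: contraNT Gu => uk.
  by rewrite (dhomog_nemf_coeff homGk uk).
by rewrite mdegE (bigD1 j) //= leq_addr.
Qed.

Lemma generic_deriv k i : (G ^+ k.+1)^`M(i) = (G ^+ k *+ k.+1) * (g i)%:MP.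
Proof.
have GE : G^`M(i) = (g i)%:MP.
  rewrite raddf_sum (bigD1 i) //= big1 => [|j ji].
    rewrite addr0 mderivM mderivC mulr0 addr0 mderivX mnm1E eqxx scale1r.
    have -> : (U_(i) - U_(i))%MM = 0%MM by apply/mnmP => j; rewrite mnmBE mnm0E subnn.
    by rewrite mpolyX0 mul1r.
  by rewrite mderivM mderivC mulr0 addr0 mderivX mnm1E (negPf ji) scale0r mul0r.
elim: k => [|k IHk]; first by rewrite expr1 expr0 mul1r.
rewrite exprS mderivM IHk GE mulrA mulrnAr -exprS [in RHS]mulrS mulrDl.
by rewrite [(g i)%:MP * _]mulrC.
Qed.

(* Differentiating G ^ k with respect to X_i gives k g_i G ^ (k - 1), and k is
   invertible because k < p. *)
Lemma idealX_content k : (k < p)%N -> idealX a k `<=` content (G ^+ k).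
Proof.
elim: k => [|k IHk] kp.
  by move=> x _; apply: content1.
have iC := content_ideal (G ^+ k.+1).
apply: (idealM_min iC) => x y ax /(IHk (ltnW kp)) Cy.
have iCx : is_ideal [set x | content (G ^+ k.+1) (x * y)].
  split=> [|u v Du Dv|r u Du] /=.
  - by rewrite mul0r; apply: (ideal0 iC).
  - by rewrite mulrDl; apply: (idealD iC).
  - by rewrite -mulrA; apply: (idealMl _ iC).
apply: (idealgen_min iCx _ ax) => _ [i _ <-] /= {x ax iCx}.
have iCy : is_ideal [set y | content (G ^+ k.+1) (g i * y)].
  split=> [|u v Du Dv|r u Du] /=.
  - by rewrite mulr0; apply: (ideal0 iC).
  - by rewrite mulrDr; apply: (idealD iC).
  - by rewrite mulrCA; apply: (idealMl _ iC).
apply: (idealgen_min iCy _ Cy) => _ [b _ <-] /= {y Cy iCy}.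
have [d dk] := pchar_natr_inverse pR (kp : (0 < k.+1 < p)%N).
have := congr1 (mcoeff b) (generic_deriv k i).
rewrite mcoeff_mderiv mulrC mcoeffCM mcoeffMn => E.
have -> : g i * (G ^+ k)@_b = d * ((G ^+ k.+1)@_(b + U_(i)) *+ (b i).+1).
  by rewrite E -[_ *+ k.+1]mulr_natl -[LHS]mul1r -{1}dk; ring.
apply: (idealMl _ iC); rewrite -mulr_natl; apply: (idealMl _ iC).
exact: content_coef.
Qed.

Lemma generic_digits k : G ^+ k =
  \prod_(i < (trunc_log p k).+1) (G ^+ (k %/ p ^ i %% p)) ^+ (p ^ i).
Proof.
have kL := trunc_log_ltn k (prime_gt1 pp).
rewrite {1}(base_expansion (prime_gt0 pp) kL) -prodrXr.
by apply: eq_bigr => i _; rewrite exprM.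
Qed.

Lemma generic_coefs_gfrob_pow k : coefs_in (gfrob_pow p a k) (G ^+ k).
Proof.
rewrite generic_digits /gfrob_pow.
apply: (big_ind2 (fun I f => coefs_in I f)) => //.
  by move=> I f J h; apply: coefs_inM.
move=> i _; apply: coefs_in_frob; first exact/pchar_natX/mpoly_pchar.
by apply: coefs_inX; apply: generic_coefs.
Qed.

Lemma gfrob_pow_content k : gfrob_pow p a k `<=` content (G ^+ k).
Proof.
rewrite generic_digits; apply: content_digits => // i.
  by apply: idealX_content; rewrite ltn_mod prime_gt0.
move=> u /generic_exponents uk j; apply: leq_ltn_trans (uk j) _.
by rewrite ltn_mod prime_gt0.
Qed.

(** The product lies in the factor of the leading digit, which is nonzero and has position at least
    [e]. *)
Lemma gfrob_pow_large k e : (p ^ e <= k)%N -> gfrob_pow p a k `<=` frob_pow a (p ^ e).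
Proof.
move=> ek; have k0 : (0 < k)%N by apply: leq_trans ek; rewrite expn_gt0 prime_gt0.
have p1 := prime_gt1 pp.
set r := trunc_log p k.
have er : (e <= r)%N by apply: trunc_log_max.
have [rk kr] := andP (trunc_log_bounds p1 k0).
have d0 : (0 < k %/ p ^ r %% p)%N.
  have q0 : (0 < p ^ r)%N by rewrite expn_gt0 prime_gt0.
  by rewrite modn_small ?divn_gt0 // ltn_divLR // -expnS.
have top : frob_pow (idealX a (k %/ p ^ r %% p)) (p ^ r) `<=` frob_pow a (p ^ e).
  have ia : is_ideal a by apply: idealgen_ideal.
  apply: idealgen_min; first exact: frob_pow_ideal.
  move=> _ [x Ix <-]; rewrite -(subnKC er) expnD exprM.
  have ax : a x.
    case: (k %/ p ^ r %% p)%N d0 Ix => // d _; apply: (idealM_min ia).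
    by move=> y z ay _; apply: (idealMr _ ia).
  apply: (ideal_exp (frob_pow_ideal _ _)); first by rewrite expn_gt0 prime_gt0.
  by apply: idealgen_sub; exists x.
apply: subset_trans top; apply: (@big_idealM_sub _ _ _ ord_max) => i.
exact: frob_pow_ideal.
Qed.

Lemma principal_idealX k : idealX (idealgen [set G]) k `<=` idealgen [set G ^+ k].
Proof.
elim: k => [|k IHk].
  move=> f _; rewrite -[f]mulr1; apply: (idealMl _ (idealgen_ideal _)).
  exact: idealgen_sub.
apply: (idealM_min (idealgen_ideal _)) => x y /principal_idealP[d ->].
move=> /IHk /principal_idealP[d' ->]; rewrite mulrACA -exprS.
by apply: (idealMl _ (idealgen_ideal _)); apply: idealgen_sub.
Qed.

Lemma idealX_in k : idealX (idealgen [set G]) k (G ^+ k).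
Proof.
by elim: k => [//|k IHk]; rewrite exprS; apply: idealM_in => //; apply: idealgen_sub.
Qed.

(** A candidate [b] for the root in [R] yields the candidate [coefs_in b] for the root in the
    polynomial ring; the constant coefficient of 1 is then in [b]. *)
Lemma frob_root_generic_unit k e :
  frob_root (idealX (idealgen [set G]) k) (p ^ e) 1 ->
  frob_root (gfrob_pow p a k) (p ^ e) 1.
Proof.
move=> root1 b [ib ab].
have ic := coefs_in_ideal m ib.
have : coefs_in b (1 : {mpoly R[m]}).
  apply: (root1 (coefs_in b)); split=> //.
  apply: (subset_trans (@principal_idealX k)); apply: idealgen_min.
    exact: frob_pow_ideal.
  move=> _ ->; apply: frob_pow_coefs => // u.
  by apply: ab; apply: generic_coefs_gfrob_pow.
by move=> /(_ 0%MM); rewrite mcoeff1 eqxx.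
Qed.

End GenericCombination.

Lemma frob_root_unit_generic (p m : nat) (R : idomainType) (g : 'I_m -> R) k e :
  p \in [pchar R] -> F_finite R p -> regular_domain R ->
  idealgen (range g) <> setT ->
  frob_root (gfrob_pow p (idealgen (range g)) k) (p ^ e) 1 ->
  frob_root (idealX (idealgen [set (\sum_(i < m) 'X_i * (g i)%:MP : {mpoly R[m]})]) k)
    (p ^ e) 1.
Proof.
move=> pR Ffin [noethR regR] aT root1 c [ic Gc].
set G := \sum_(i < m) _ in Gc *.
have ia : is_ideal (idealgen (range g)) by apply: idealgen_ideal.
(* For [k] at least [p ^ e], the proper ideal of the [g i] is itself a candidate for the root, which
   therefore cannot contain 1. *)
have [ke|ke] := leqP (p ^ e) k.
  exfalso; apply: aT; apply: ideal_unit => //; apply: root1; split=> //.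
  exact: gfrob_pow_large.
apply: contrapT => nc1.
pose b := [set x : R | c x%:MP].
have ib : is_ideal b.
  split=> [|x y cx cy|r x cx]; rewrite /b /=.
  - by rewrite rmorph0; apply: (ideal0 ic).
  - by rewrite rmorphD; apply: (idealD ic).
  - by rewrite rmorphM; apply: (idealMl _ ic).
have [|M Mmax bM] := maximal_over noethR ib; first by rewrite /b /= rmorph1.
have MP := maximal_prime Mmax.
have chR := pchar_natX e pR; have chS := pchar_natX e (mpoly_pchar m pR).
have [N [f [spanf indf]]] := regular_basis pR chR (regR (PrimeIdeal MP)) (F_finiteX e pR Ffin).
have MG : coefs_in (frob_pow M (p ^ e)) (G ^+ k).
  apply: (frob_pow_coef chR chS Mmax spanf indf ic) => //.
  - by move=> u /generic_exponents uk j; apply: leq_ltn_trans (uk j) ke.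
  - by apply: Gc; apply: idealX_in.
(* [gfrob_pow] lies in the content of [G ^+ k], so [M] is a candidate for its root and would contain
   1. *)
have [iM nM1 _] := MP; apply: nM1; apply: root1; split=> //.
apply: (subset_trans (@gfrob_pow_content _ _ g _ pR k)).
apply: idealgen_min; first exact: frob_pow_ideal.
by move=> _ [u _ <-]; apply: MG.
Qed.

Lemma bigcup_ideals_setT (S : comNzRingType) (I : nat -> set S) :
  (forall e, is_ideal (I e)) ->
  \bigcup_(e in [set: nat]) I e = setT <-> exists e, I e 1.
Proof.
move=> iI; split=> [IT|[e Ie1]]; last first.
  by apply/seteqP; split=> // x _; exists e => //; rewrite (ideal_unit (iI e) Ie1).
have [e _ Ie1] : (\bigcup_(e in [set: nat]) I e) 1 by rewrite IT.
by exists e.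
Qed.

Theorem corollary5p5 (K : realType) (p : nat) (R : idomainType)
    (m : nat) (g : 'I_m -> R) :
  p \in [pchar R] -> F_finite R p -> regular_domain R ->
  idealgen (range g) <> [set 0] -> idealgen (range g) <> setT ->
  lce K p (idealgen (range g)) =
  fpt_elt K p (\sum_(i < m) 'X_i * (g i)%:MP : {mpoly R[m]}).
Proof.
move=> pR Ffin regR _ aT; rewrite /lce /fpt_elt /fpt; congr sup.
(* The sets under the two suprema coincide: the same [e] witnesses both unions, since both use the
   exponent [ceil_pow t e]. *)
apply/seteqP; split=> t [t0 tT]; split=> //.
- have [e root1] := (bigcup_ideals_setT (fun e => frob_root_ideal _ _)).1 tT.
  apply/(bigcup_ideals_setT (fun e => frob_root_ideal _ _)).
  by exists e; apply: frob_root_unit_generic.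
- have [e root1] := (bigcup_ideals_setT (fun e => frob_root_ideal _ _)).1 tT.
  apply/(bigcup_ideals_setT (fun e => frob_root_ideal _ _)).
  by exists e; apply: frob_root_generic_unit.
Qed.
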